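(* Let $k\ge 2$ and let $\mathbf{a}=(1,\dots,1,-1,\dots,-1)\in\mathbb{Z}^{2k}$ with $k$ entries $1$ followed by $k$ entries $-1$. Let $\Gamma$ be the spherical hypertree on $\{1,\dots,2k+2\}$ associated to the bicolored bipyramidal triangulation of the two-sphere with poles $2k+1$ and $2k+2$ and with $2k$ equatorial vertices alternating between $\{1,\dots,k\}$ and $\{k+1,\dots,2k\}$ (so with $2k$ triangles of each color). Then $\Lambda_{\mathbf a}=D_\Gamma$ as divisors on $\overline{M}_{0,2k+2}$.
   Context: The base field is algebraically closed. $M_{0,m}$ is the moduli space of $m$ distinct ordered marked points on $\mathbb{P}^1$ modulo $PGL_2$, and $\overline{M}_{0,m}$ is its Deligne--Mumford compactification. Chen--Coskun divisors. Let $\varphi\colon \overline{M}_{0,n+2} \to \overline{M}_{1,n}$ be the clutching morphism gluing the marked points $n+1$ and $n+2$ to a node. For $\mathbf{a}=(a_1,\dots,a_n)\in\mathbb{Z}^n$ with $\sum_i a_i=0$ and $\gcd(a_1,\dots,a_n)=1$, let $D_{\mathbf a}$ be the closure in $\varphi(\overline{M}_{0,n+2})$ of the locus of irreducible nodal curves $[C;p_1,\dots,p_n]$ of arithmetic genus $1$ with $n$ distinct smooth marked points such that $\sum_{i=1}^n a_i p_i = 0$ in $\operatorname{Pic}^0(C)\simeq\mathbb{G}_m$. Then $\Lambda_{\mathbf a}\subset\overline{M}_{0,n+2}$ is the proper transform of $D_{\mathbf a}$ under $\varphi$, i.e. the closure of $\varphi^{-1}(D_{\mathbf a})\cap M_{0,n+2}$.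 Hypertrees. A hypertree on a finite set $N$ is a collection $\Gamma=\{\Gamma_1,\dots,\Gamma_d\}$ of subsets of $N$ such that: (1) $|\Gamma_j|\ge 3$ for all $j$; (2) each $i\in N$ lies in at least two distinct $\Gamma_j$; (3) $|\bigcup_{j\in S}\Gamma_j|-2\ge\sum_{j\in S}(|\Gamma_j|-2)$ for every nonempty $S\subset\{1,\dots,d\}$; (4) $|N|-2=\sum_{j=1}^d(|\Gamma_j|-2)$. A planar realization of a hypertree $\Gamma$ on $\{1,\dots,m\}$ is a collection of points $p_1,\dots,p_m\in\mathbb{P}^2$ such that distinct $p_i,p_j,p_l$ are collinear if and only if $i,j,l\in\Gamma_\alpha$ for some $\alpha$. The hypertree divisor $D_\Gamma\subset\overline{M}_{0,m}$ is the closure of the locus of $[\mathbb{P}^1;q_1,\dots,q_m]\in M_{0,m}$ for which there are a planar realization $\{p_i\}$ and a projection $\pi$ from a point of $\mathbb{P}^2$ to $\mathbb{P}^1$ with $q_i=\pi(p_i)$ for all $i$. Spherical hypertrees. Given a triangulation of the two-sphere with vertex set $\{1,\dots,m\}$ whose triangles are colored black and white so that adjacent triangles have different colors, the triples of vertices of the black triangles form a hypertree, called spherical. For the bipyramid with equatorial vertices $v_1,\dots,v_{2k}$ in cyclic order ($v_{\mathrm{odd}}\in\{1,\dots,k\}$, $v_{\mathrm{even}}\in\{k+1,\dots,2k\}$, $v_{2k+1}:=v_1$), this is $\Gamma=\{\{v_{2j-1},v_{2j},2k+1\},\{v_{2j},v_{2j+1},2k+2\}: 1\le j\le k\}$. 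*)

(* Defs.v *)
From HB Require Import structures.
From mathcomp Require Import all_boot all_order all_algebra.
From mathcomp Require Import generic_quotient.
From mathcomp Require Import boolp classical_sets topology.
Set Implicit Arguments.
Unset Strict Implicit.
Unset Printing Implicit Defensive.
Import GRing.Theory.
Local Open Scope ring_scope.
Local Open Scope quotient_scope.
Local Open Scope classical_set_scope.

(** [P1 K] is [K] together with the point at infinity [None]; [(hx p, hy p)]
    are homogeneous coordinates of [p], and [ratio x y] is the point [x : y]
    (with a junk value for [x = y = 0]). *)

Notation P1 K := (option K).

Section P1.
Variable K : fieldType.
Implicit Types (p q : P1 K) (M : 'M[K]_2).

Definition hx p : K := if p is Some x then x else 1.
Definition hy p : K := if p is Some _ then 1 else 0.
Definition ratio (x y : K) : P1 K := if y == 0 then None else Some (x / y).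

Definition mobius M p : P1 K :=
  ratio (M ord0 ord0 * hx p + M ord0 ord_max * hy p)
        (M ord_max ord0 * hx p + M ord_max ord_max * hy p).

Definition bracket p q : K := hx p * hy q - hx q * hy p.

Lemma ratio_scale (c x y : K) : c != 0 -> ratio (c * x) (c * y) = ratio x y.
Proof.
move=> c0; rewrite /ratio mulf_eq0 (negbTE c0) /=.
by case: eqP => // _; rewrite -mulf_div divff ?mul1r.
Qed.

Lemma ratio_hxhy p : ratio (hx p) (hy p) = p.
Proof. by case: p => [x|]; rewrite /ratio /= ?oner_eq0 ?divr1 ?eqxx. Qed.

Lemma hxhy_ratio (x y : K) : (x != 0) || (y != 0) ->
  exists2 c, c != 0 & x = c * hx (ratio x y) /\ y = c * hy (ratio x y).
Proof.
rewrite /ratio; case: (eqVneq y 0) => [->|y0 _] /=; first rewrite orbF.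
  by move=> x0; exists x => //; rewrite mulr1 mulr0.
by exists y => //; rewrite mulr1 mulrCA divff ?mulr1.
Qed.

Lemma mobius1 p : mobius 1%:M p = p.
Proof.
rewrite /mobius !mxE /= !mulr1n !mulr0n !mul0r !mul1r addr0 add0r.
exact: ratio_hxhy.
Qed.

Lemma hxhy_neq0 p : (hx p != 0) || (hy p != 0).
Proof. by case: p => [x|] /=; rewrite oner_eq0 ?orbT. Qed.

Definition colv (x y : K) : 'cV[K]_2 := \col_i (if i == ord0 then x else y).

Lemma mulmx_colv M x y :
  M *m colv x y = colv (M ord0 ord0 * x + M ord0 ord_max * y)
                       (M ord_max ord0 * x + M ord_max ord_max * y).
Proof.
apply/matrixP => i j; rewrite !mxE !big_ord_recl big_ord0 addr0 !mxE /=.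
have -> : lift ord0 ord0 = ord_max :> 'I_2 by apply/val_inj.
by case: eqP => [->|/eqP i0] //; have -> : i = ord_max
  by apply/val_inj; case: i i0 => [[|[|]]].
Qed.

Lemma colv_inj x y x' y' : colv x y = colv x' y' -> x = x' /\ y = y'.
Proof.
by move/matrixP => e; move: (e ord0 ord0) (e ord_max ord0); rewrite !mxE.
Qed.

Lemma mobius_nondeg M x y : M \in unitmx -> (x != 0) || (y != 0) ->
  (M ord0 ord0 * x + M ord0 ord_max * y != 0) ||
  (M ord_max ord0 * x + M ord_max ord_max * y != 0).
Proof.
move=> uM; apply: contraTT; rewrite !negb_or !negbK => /andP[/eqP e1 /eqP e2].
have : M *m colv x y = M *m colv 0 0.
  by rewrite !mulmx_colv e1 e2 !mulr0 !addr0.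
move/(congr1 (mulmx (invmx M))); rewrite !mulKmx // => /colv_inj[-> ->].
by rewrite eqxx.
Qed.

Lemma mobiusM M N p : N \in unitmx -> mobius (M *m N) p = mobius M (mobius N p).
Proof.
move=> uN; rewrite [mobius N p]/mobius.
set x := _ + _; set y := _ + _.
have [c c0 [ex ey]] := hxhy_ratio (mobius_nondeg uN (hxhy_neq0 p)).
rewrite -/x -/y in ex ey.
rewrite {2}/mobius -(ratio_scale _ _ c0) !mulrDr !(mulrCA c) -ex -ey.
have : (M *m N) *m colv (hx p) (hy p) = M *m (N *m colv (hx p) (hy p)).
  by rewrite mulmxA.
by rewrite !mulmx_colv -/x -/y => /colv_inj[e1 e2]; rewrite /mobius e1 e2.
Qed.

End P1.

(** An [n]-pointed nodal curve all of whose components have normalization the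
    projective line, described on its normalization: [special (inl i)] is the
    [i]-th marked point, and the two points [special (inr (e, false))] and
    [special (inr (e, true))] are identified to the node [e]. *)

Record curve (K : fieldType) (n : nat) := Curve {
  ncomp : nat;
  nnode : nat;
  special : 'I_n + 'I_nnode * bool -> 'I_ncomp * P1 K;
  special_inj : injective special }.

Definition flip (N : nat) (x : 'I_N * bool) : 'I_N * bool := (x.1, ~~ x.2).

Section Curves.
Variables (K : fieldType) (n : nat).
Implicit Types C D E : curve K n.

Definition comp C (x : 'I_n + 'I_(nnode C) * bool) : 'I_(ncomp C) :=
  (special x).1.

Definition pos C (i : 'I_n) : P1 K := (special (inl i : _ + 'I_(nnode C) * _)).2.

Definition adj C : rel 'I_(ncomp C) :=
  [rel u v | [exists x : 'I_(nnode C) * bool,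
     (comp (inr x) == u) && (comp (inr (flip x)) == v)]].

(* A connected curve of this kind has arithmetic genus
   [nnode C - ncomp C + 1]. *)
Definition stable (g : nat) C : bool :=
  [&& (0 < ncomp C)%N,
      [forall u, forall v, connect (@adj C) u v],
      (nnode C).+1 == (ncomp C + g)%N &
      [forall v, 2 < #|[pred x | comp (C := C) x == v]|]%N].

Definition iso C D : Prop :=
  exists (s : 'I_(ncomp C) -> 'I_(ncomp D)) (M : 'I_(ncomp C) -> 'M[K]_2)
         (t : 'I_(nnode C) * bool -> 'I_(nnode D) * bool),
  [/\ bijective s, bijective t, forall v, M v \in unitmx,
      forall x, t (flip x) = flip (t x) &
      (forall i, special (c := D) (inl i) =
         let: (v, p) := special (c := C) (inl i) in (s v, mobius (M v) p)) /\
      (forall x, special (c := D) (inr (t x)) =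
         let: (v, p) := special (c := C) (inr x) in (s v, mobius (M v) p))].

Lemma iso_refl C : iso C C.
Proof.
exists id, (fun=> 1%:M), id; split => //; try by exists id.
- by move=> v; rewrite unitmx1.
- by split=> x; case: special => v p; rewrite mobius1.
Qed.

Lemma iso_sym C D : iso C D -> iso D C.
Proof.
case=> s [M] [t] [[s' sK s'K] [t' tK t'K] uM tf [h1 h2]].
exists s', (fun w => invmx (M (s' w))), t'; split.
- by exists s.
- by exists t.
- by move=> v; rewrite unitmx_inv.
- by move=> x; apply: (can_inj tK); rewrite tf !t'K.
- have act v p : (s' (s v), mobius (invmx (M (s' (s v)))) (mobius (M v) p))
               = (v, p).
    by rewrite sK -mobiusM // mulVmx // mobius1.
  split=> [i|x]; first by rewrite h1; case: special => v p; rewrite act.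
  by rewrite -[in RHS](t'K x) h2; case: special => v p; rewrite act.
Qed.

Lemma iso_trans C D E : iso C D -> iso D E -> iso C E.
Proof.
case=> s [M] [t] [bs bt uM tf [h1 h2]] [s2] [M2] [t2] [bs2 bt2 uM2 tf2 [k1 k2]].
exists (s2 \o s), (fun v => M2 (s v) *m M v), (t2 \o t); split.
- exact: bij_comp.
- exact: bij_comp.
- by move=> v; rewrite unitmx_mul uM uM2.
- by move=> x; rewrite /= tf tf2.
- split=> [i|x]; first by rewrite k1 h1; case: special => v p; rewrite mobiusM.
  by rewrite /= k2 h2; case: special => v p; rewrite mobiusM.
Qed.

End Curves.

(** [Mrat K g n] is the set of isomorphism classes of stable [n]-pointed curves
    of arithmetic genus [g] all of whose components are rational.  For [g = 0]
    this is every stable curve; for [g = 1] it is the image of the clutching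
    morphism. *)

Record scurve (K : fieldType) (g n : nat) := SCurve {
  curve_of :> curve K n;
  curve_of_stable : stable g curve_of }.

HB.instance Definition _ K g n := gen_eqMixin (scurve K g n).
HB.instance Definition _ K g n := gen_choiceMixin (scurve K g n).

Section Moduli.
Variables (K : fieldType) (g n : nat).

Definition isob (C D : scurve K g n) : bool := `[< iso C D >].

Lemma isob_refl : reflexive isob.
Proof. by move=> C; apply/asboolP/iso_refl. Qed.

Lemma isob_sym : symmetric isob.
Proof. by move=> C D; apply/asboolP/asboolP; apply: iso_sym. Qed.

Lemma isob_trans : transitive isob.
Proof. by move=> D C E /asboolP h1 /asboolP h2; apply/asboolP/(iso_trans h1). Qed.

Definition iso_equiv := EquivRel isob isob_refl isob_sym isob_trans.

Definition Mrat : Type := {eq_quot iso_equiv}.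
HB.instance Definition _ := Quotient.on Mrat.
HB.instance Definition _ := Choice.on Mrat.

Lemma Mrat_eqP (C D : scurve K g n) : \pi_Mrat C = \pi_Mrat D <-> iso C D.
Proof.
split; first by move/eqP; rewrite eqmodE => /asboolP.
by move=> h; apply/eqP; rewrite eqmodE; apply/asboolP.
Qed.

End Moduli.

Definition Mbar0 (K : fieldType) (m : nat) : Type := Mrat K 0 m.
HB.instance Definition _ K m := Quotient.copy (Mbar0 K m) (Mrat K 0 m).
HB.instance Definition _ K m := Choice.copy (Mbar0 K m) (Mrat K 0 m).

Definition Delta (K : fieldType) (n : nat) : Type := Mrat K 1 n.
HB.instance Definition _ K n := Quotient.copy (Delta K n) (Mrat K 1 n).
HB.instance Definition _ K n := Choice.copy (Delta K n) (Mrat K 1 n).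

(** The open stratum of irreducible (hence smooth) curves. *)
Definition M0 (K : fieldType) (m : nat) : set (Mbar0 K m) :=
  [set x | exists2 C : scurve K 0 m, x = \pi_(Mbar0 K m) C & ncomp C = 1%N].

(** The Zariski topology on [Mbar0 K m] is induced by its closed embedding in
    the product of projective lines, one for each sequence of four distinct marked
    points, given by the forgetful maps to the moduli space of four-pointed
    curves, that is, by the cross-ratios (Gerritzen, Herrlich, van der Put,
    "Stable n-pointed trees of projective lines"). *)

Section CrossRatio.
Variables (K : fieldType) (m : nat).
Implicit Type C : curve K m.

Definition adj_off C (v : 'I_(ncomp C)) : rel 'I_(ncomp C) :=
  [rel u w | [&& adj u w, u != v & w != v]].

(* The image of the [i]-th marked point under the contraction of the tree [C]
   onto its component [v]: the point itself if it lies on [v], and otherwise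
   the node of [v] leading to it. *)
Definition retract C (v : 'I_(ncomp C)) (i : 'I_m) : P1 K :=
  if comp (C := C) (inl i) == v then pos C i else
  if [pick x : 'I_(nnode C) * bool | (comp (inr x) == v) &&
        connect (adj_off v) (comp (inr (flip x))) (comp (C := C) (inl i))]
  is Some x then (special (inr x)).2 else None.

Definition quad := {t : 4.-tuple 'I_m | uniq t}.

Definition cross_num C (t : quad) (v : 'I_(ncomp C)) : K :=
  let r j := retract v (tnth (val t) j) in
  bracket (r (inord 0)) (r (inord 2)) * bracket (r (inord 1)) (r (inord 3)).

Definition cross_den C (t : quad) (v : 'I_(ncomp C)) : K :=
  let r j := retract v (tnth (val t) j) in
  bracket (r (inord 0)) (r (inord 3)) * bracket (r (inord 1)) (r (inord 2)).

(* The cross-ratio is computed on any component onto which the four points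
   retract to at least three distinct points, that is, where the numerator and
   the denominator do not both vanish; on a stable tree there is such a
   component and the value does not depend on its choice. *)
Definition cross_ratio C (t : quad) : P1 K :=
  if [pick v : 'I_(ncomp C) | (cross_num t v != 0) || (cross_den t v != 0)]
  is Some v then ratio (cross_num t v) (cross_den t v) else None.

End CrossRatio.

(** Multihomogeneous polynomials on a product of projective lines indexed by
    [I], of multidegree [d], evaluated at the coordinates [(hx, hy)]. *)
Inductive mhomog (K : fieldType) (I : eqType) :
    (I -> nat) -> ((I -> P1 K) -> K) -> Prop :=
| mhomog_const c : mhomog (fun=> 0%N) (fun=> c)
| mhomog_x i : mhomog (fun j => (j == i) : nat) (fun z => hx (z i))
| mhomog_y i : mhomog (fun j => (j == i) : nat) (fun z => hy (z i))
| mhomog_add d f h : mhomog d f -> mhomog d h ->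
    mhomog d (fun z => f z + h z)
| mhomog_mul d d' f h : mhomog d f -> mhomog d' h ->
    mhomog (fun j => d j + d' j)%N (fun z => f z * h z).

Definition Mbar0_subbase (K : fieldType) (m : nat) : set (set (Mbar0 K m)) :=
  [set U | exists (d : quad m -> nat) (f : (quad m -> P1 K) -> K),
     mhomog d f /\ U = [set x | f (cross_ratio (repr x : scurve K 0 m)) != 0]].

HB.instance Definition _ K m :=
  isSubBaseTopological.Build (Mbar0 K m) (@Mbar0_subbase K m) id.

(** The labels [1, .., n] are the ordinals [0, .., n - 1] of ['I_n], and the
    additional labels [n + 1] and [n + 2] are [pole1] and [pole2]. *)

Definition pt (n : nat) (i : 'I_n) : 'I_n.+2 := widen_ord (leqW (leqnSn n)) i.
Definition pole1 (n : nat) : 'I_n.+2 := widen_ord (leqnSn n.+1) ord_max.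
Definition pole2 (n : nat) : 'I_n.+2 := ord_max.

Section Glue.
Variables (K : fieldType) (n : nat).

Definition glue_label (N : nat) (x : 'I_n + 'I_N.+1 * bool) :
    'I_n.+2 + 'I_N * bool :=
  match x with
  | inl i => inl (pt i)
  | inr (e, b) =>
      if unlift ord_max e is Some e' then inr (e', b)
      else inl (if b then pole2 n else pole1 n)
  end.

Lemma glue_label_inj N : injective (@glue_label N).
Proof.
have pt12 (i : 'I_n) b : pt i <> (if b then pole2 n else pole1 n).
  move/(congr1 val) => /= e; have := ltn_ord i.
  by case: b e => /= ->; rewrite ltnNge ?leqnn ?leqnSn.
move=> [i|[e b]] [j|[e' b']] /=.
- by case=> h; congr inl; apply/val_inj.
- by case: unliftP => [?|] _ // [] /pt12.
- by case: unliftP => [?|] _ // [] /esym /pt12.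
case: unliftP => [f|] ->; case: unliftP => [f'|] -> //; first by case=> -> ->.
by case: b b' => [] [] // [] /eqP; rewrite ?(gtn_eqF (ltnSn _)) ?(ltn_eqF (ltnSn _)).
Qed.

Lemma glue_label_bij N : bijective (@glue_label N).
Proof.
apply: (inj_card_bij (@glue_label_inj N)).
by rewrite !card_sum !card_prod !card_ord card_bool mulSn addnA addn2.
Qed.

(* The curve obtained by gluing the last two marked points to a node. *)
Definition glue (C : curve K n.+2) : curve K n :=
  Curve (inj_comp (@special_inj _ _ C) (@glue_label_inj (nnode C))).

Lemma adj_glue (C : curve K n.+2) (u v : 'I_(ncomp C)) :
  adj u v -> adj (C := glue C) u v.
Proof.
case/existsP => -[e b] /andP[h1 h2]; apply/existsP; exists (lift ord_max e, b).
by rewrite /comp /= !liftK; apply/andP; split.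
Qed.

Lemma glue_stable (g : nat) (C : curve K n.+2) :
  stable g C -> stable g.+1 (glue C).
Proof.
case/and4P => h0 /forallP hc /eqP hg /forallP h3; apply/and4P; split => //.
- apply/forallP => u; apply/forallP => v.
  have /forallP/(_ v) := hc u; apply: connect_sub => x y xy.
  exact/connect1/adj_glue.
- by rewrite /= hg addnS.
- apply/forallP => v; apply: leq_trans (h3 v) _.
  have [l lK l'K] := glue_label_bij (nnode C).
  rewrite -(card_image (can_inj l'K)); apply/subset_leq_card/fintype.subsetP.
  move=> y /mapP[x]; rewrite mem_enum !inE => xv ->.
  by rewrite /comp /= l'K.
Qed.

Definition sglue (C : scurve K 0 n.+2) : scurve K 1 n :=
  SCurve (glue_stable (curve_of_stable C)).

Definition clutch (x : Mbar0 K n.+2) : Delta K n :=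
  \pi_(Delta K n) (sglue (repr x)).

Lemma glue_iso (C D : curve K n.+2) : iso C D -> iso (glue C) (glue D).
Proof.
case=> s [M] [t] [bs [t' tK t'K] uM tf [h1 h2]].
pose ext a b (f : 'I_a * bool -> 'I_b * bool) (x : 'I_a.+1 * bool) :
    'I_b.+1 * bool :=
  if unlift ord_max x.1 is Some e then
    (lift ord_max (f (e, x.2)).1, (f (e, x.2)).2) else (ord_max, x.2).
have extK a b (f : 'I_a * bool -> 'I_b * bool) f' :
    cancel f f' -> cancel (ext a b f) (ext b a f').
  move=> fK [e b0]; rewrite /ext /=; case: (unliftP ord_max e) => [e'|] -> /=.
    by rewrite liftK -surjective_pairing fK.
  by rewrite unlift_none.
exists s, M, (ext _ _ t); split => //.
- by exists (ext _ _ t'); apply: extK.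
- move=> [e b]; rewrite /ext /flip /=; case: unliftP => [e'|] _ //=.
  by have := tf (e', b); rewrite /flip /= => ->.
- split=> [i|[e b]]; first exact: h1.
  rewrite /ext /=; case: unliftP => [e'|] _ /=.
    by rewrite liftK -surjective_pairing; apply: h2.
  by rewrite unlift_none; apply: h1.
Qed.

Lemma clutch_pi (C : scurve K 0 n.+2) :
  clutch (\pi_(Mbar0 K n.+2) C) = \pi_(Delta K n) (sglue C).
Proof.
apply/(Mrat_eqP (sglue (repr (\pi_(Mbar0 K n.+2) C))) (sglue C))/glue_iso.
by apply/(Mrat_eqP (repr (\pi_(Mbar0 K n.+2) C)) C); apply: reprK.
Qed.

End Glue.

(** The clutching morphism is proper, so that the Zariski topology of its image
    is the quotient topology. *)
Definition Delta_open (K : fieldType) (n : nat) : set (set (Delta K n)) :=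
  [set U | open (@clutch K n @^-1` U)].

Section DeltaTopology.
Variables (K : fieldType) (n : nat).

Lemma Delta_openT : @Delta_open K n setT.
Proof. exact: openT. Qed.

Lemma Delta_openI : setI_closed (@Delta_open K n).
Proof. by move=> U V oU oV; apply: openI. Qed.

Lemma Delta_open_bigU (I : Type) (f : I -> set (Delta K n)) :
  (forall i, Delta_open (f i)) -> Delta_open (\bigcup_i f i).
Proof.
move=> h; rewrite /Delta_open /= preimage_bigcup.
by apply: bigcup_open => i _; apply: h.
Qed.

HB.instance Definition _ := isOpenTopological.Build (Delta K n)
  Delta_openT Delta_openI Delta_open_bigU.

End DeltaTopology.

Section ChenCoskun.
Variables (K : fieldType) (n : nat).

(* Order and value at [p] of the rational function [F / G] on the projective
   line; the value is only meaningful if [F] and [G] are coprime and the order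
   is zero. *)
Definition rat_ord (F G : {poly K}) (p : P1 K) : int :=
  if p is Some x then (mup x F)%:Z - (mup x G)%:Z
  else (size G)%:Z - (size F)%:Z.

Definition rat_val (F G : {poly K}) (p : P1 K) : K :=
  if p is Some x then F.[x] / G.[x] else lead_coef F / lead_coef G.

(* For [C] irreducible: the divisor of the marked points with multiplicities
   [a] is the divisor of a rational function on [C] that is regular and
   invertible at the nodes, that is, of a rational function on the
   normalization taking the same nonzero value at both branches of a node
   (where its order is zero, the marked points being smooth points of [C]). *)
Definition trivial_in_Pic (a : 'I_n -> int) (C : curve K n) : Prop :=
  exists F G : {poly K},
  [/\ F != 0, G != 0, coprimep F G,
      forall p, rat_ord F G p = \sum_(i < n | pos C i == p) a i &
      forall e : 'I_(nnode C),
        rat_val F G (special (inr (e, false))).2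
        = rat_val F G (special (inr (e, true))).2].

Definition chen_coskun_locus (a : 'I_n -> int) : set (Delta K n) :=
  [set x | exists C : scurve K 1 n,
     [/\ x = \pi_(Delta K n) C, ncomp C = 1%N & trivial_in_Pic a C]].

Definition chen_coskun (a : 'I_n -> int) : set (Delta K n) :=
  closure (chen_coskun_locus a).

Definition Lambda (a : 'I_n -> int) : set (Mbar0 K n.+2) :=
  closure ((@clutch K n @^-1` chen_coskun a) `&` @M0 K n.+2).

End ChenCoskun.

Definition hypertree (N : finType) (Gamma : {set {set N}}) : Prop :=
  [/\ forall A, A \in Gamma -> (2 < #|A|)%N,
      forall i : N, exists A B, [/\ A \in Gamma, B \in Gamma, A != B,
        i \in A & i \in B],
      forall S : {set {set N}}, S \subset Gamma -> S != finset.set0 ->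
        (\sum_(A in S) (#|A| - 2) + 2 <= #|finset.cover S|)%N &
      #|N| = (\sum_(A in Gamma) (#|A| - 2) + 2)%N].

(* Points of the projective plane are given by nonzero row vectors. *)
Section HypertreeDivisor.
Variables (K : fieldType) (m : nat).

Definition collinear (x y z : 'rV[K]_3) : Prop :=
  exists2 l : 'cV[K]_3, l != 0 & [/\ x *m l = 0, y *m l = 0 & z *m l = 0].

Definition planar_realization (Gamma : {set {set 'I_m}}) (p : 'I_m -> 'rV[K]_3)
    : Prop :=
  (forall i, p i != 0) /\
  forall i j l, ~~ (p i == p j)%MS -> ~~ (p j == p l)%MS -> ~~ (p i == p l)%MS ->
    (collinear (p i) (p j) (p l) <->
     exists2 A, A \in Gamma & [/\ i \in A, j \in A & l \in A]).

(* The projection is the linear projection with matrix [P], from the point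
   spanned by the kernel of [P]. *)
Definition hypertree_locus (Gamma : {set {set 'I_m}}) : set (Mbar0 K m) :=
  [set x | exists C : scurve K 0 m, [/\ x = \pi_(Mbar0 K m) C, ncomp C = 1%N &
     exists (p : 'I_m -> 'rV[K]_3) (P : 'M[K]_(3, 2)),
     [/\ planar_realization Gamma p, \rank P = 2%N &
         forall i, p i *m P != 0 /\
           pos C i = ratio ((p i *m P) ord0 ord0) ((p i *m P) ord0 ord_max)]]].

Definition hypertree_divisor (Gamma : {set {set 'I_m}}) : set (Mbar0 K m) :=
  closure (hypertree_locus Gamma).

End HypertreeDivisor.

(** [v] lists the equatorial vertices in cyclic order; its index [i] starts at
    [0], so that odd-numbered vertices have even index. *)

Definition alternating (k : nat) (v : 'I_(2 * k) -> 'I_(2 * k)) : Prop :=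
  injective v /\ forall i, (v i < k)%N = ~~ odd i.

Section Bipyramid.
Variables (n : nat) (v : 'I_n -> 'I_n).

Definition triangle (t : 'I_n * bool) : {set 'I_n.+2} :=
  [set pt (v t.1); pt (v (ordS t.1)); if t.2 then pole2 n else pole1 n]%SET.

Definition black (t : 'I_n * bool) : bool := odd t.1 == t.2.

Definition bipyramid : {set {set 'I_n.+2}} :=
  [set triangle t | t : 'I_n * bool & black t]%SET.

End Bipyramid.

Section BipyramidHypertree.
Variables (k : nat) (v : 'I_(2 * k) -> 'I_(2 * k)).
Hypotheses (hk : (2 <= k)%N) (hv : alternating v).
Let n := (2 * k)%N.
Let T (i : 'I_n) := triangle v (i, odd i).

Let v_inj : injective v. Proof. by case: hv. Qed.

Let n_gt3 : (3 < n)%N.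
Proof. by rewrite /n mul2n -(doubleS 1) leq_double. Qed.

Let pt_inj : injective (@pt n).
Proof. by move=> i j /(congr1 val) /= h; apply/val_inj. Qed.

Let pt_neq1 i : (pt i == pole1 n) = false.
Proof. by rewrite -val_eqE /= ltn_eqF ?ltn_ord. Qed.

Let pt_neq2 i : (pt i == pole2 n) = false.
Proof. by rewrite -val_eqE /= ltn_eqF // ltnS ltnW ?ltn_ord. Qed.

Let pole12 : (pole1 n == pole2 n) = false.
Proof. by rewrite -val_eqE /= ltn_eqF. Qed.

Let labelP (x : 'I_n.+2) : [\/ exists i, x = pt i, x = pole1 n | x = pole2 n].
Proof.
have := ltn_ord x; rewrite !ltnS leq_eqVlt => /orP[/eqP e|].
  by apply: Or33; apply/val_inj.
rewrite ltnS leq_eqVlt => /orP[/eqP e|lt_x].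
  by apply: Or32; apply/val_inj.
by apply: Or31; exists (Ordinal lt_x); apply/val_inj.
Qed.

Let in_T x i : (x \in T i) = [|| x == pt (v i), x == pt (v (ordS i)) |
  x == if odd i then pole2 n else pole1 n].
Proof. by rewrite !finset.inE -orbA. Qed.

Let odd_ordS (i : 'I_n) : odd (ordS i) = ~~ odd i.
Proof.
rewrite /= /n; have := ltn_ord i; rewrite leq_eqVlt => /orP[/eqP e|lt_i].
  by rewrite e modnn -[odd i]negbK -oddS e oddM.
by rewrite modn_small.
Qed.

Let ordS_neq (i : 'I_n) : ordS i != i.
Proof. by apply/eqP => /(congr1 (odd \o val)) /=; rewrite odd_ordS; case: odd. Qed.

Let pt_in_T i j : (pt (v i) \in T j) = (i == j) || (i == ordS j).
Proof.
rewrite in_T !(inj_eq pt_inj) !(inj_eq v_inj).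
by case: odd; rewrite ?pt_neq1 ?pt_neq2 orbF.
Qed.

Let pole1_in_T j : (pole1 n \in T j) = ~~ odd j.
Proof. by rewrite in_T ![_ == pt _]eq_sym !pt_neq1; case: odd; rewrite ?pole12 ?eqxx. Qed.

Let pole2_in_T j : (pole2 n \in T j) = odd j.
Proof.
by rewrite in_T ![_ == pt _]eq_sym !pt_neq2; case: odd; rewrite ?[_ == pole1 n]eq_sym ?pole12 ?eqxx.
Qed.

Let T_inj : injective T.
Proof.
move=> i j eT; have := pole2_in_T i; rewrite eT pole2_in_T => odd_ij.
have := pt_in_T i i; rewrite eT eqxx pt_in_T /= => /orP[/eqP//|/eqP e].
by move: odd_ij; rewrite e odd_ordS; case: odd.
Qed.

Let card_T i : #|T i| = 3.
Proof.
pose P := if odd i then pole2 n else pole1 n.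
have ptP j : (P == pt j) = false.
  by rewrite /P eq_sym; case: odd; rewrite ?pt_neq1 ?pt_neq2.
have -> : T i = (P |: [set pt (v i); pt (v (ordS i))])%SET by rewrite finset.setUC.
rewrite cardsU1 cards2 !finset.inE !ptP.
have -> // : pt (v i) != pt (v (ordS i)).
by rewrite (inj_eq pt_inj) (inj_eq v_inj) eq_sym ordS_neq.
Qed.

Let bipyramidE : bipyramid v = [set T i | i : 'I_n]%SET.
Proof.
apply/setP => A; apply/imsetP/imsetP => [[[i b]]|[i _ ->]].
  by rewrite !finset.inE /black /= => /eqP <- ->; exists i.
by exists (i, odd i); rewrite ?finset.inE /black.
Qed.

Let sum_T (S : {set {set 'I_n.+2}}) :
  S \subset bipyramid v -> (\sum_(A in S) (#|A| - 2))%N = #|S|.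
Proof.
move=> /fintype.subsetP sS; rewrite -sum1_card; apply: eq_bigr => A /sS.
by rewrite bipyramidE => /imsetP[i _ ->]; rewrite card_T.
Qed.

Let i0 : 'I_n := Ordinal (ltnW (ltnW (ltnW n_gt3))).
Let i1 : 'I_n := Ordinal (ltnW (ltnW n_gt3)).
Let i2 : 'I_n := Ordinal (ltnW n_gt3).
Let i3 : 'I_n := Ordinal n_gt3.

Let vP j : exists i, j = v i.
Proof. by have [w _ wK] := injF_bij v_inj; exists (w j); rewrite wK. Qed.

Let ordS_closed (J : {set 'I_n}) : J != finset.set0 ->
  (forall i, i \in J -> ordS i \in J) -> forall i, i \in J.
Proof.
move=> /set0Pn[j jJ] hJ i.
have iterJ d : iter d (@ordS n) j \in J by elim: d => //= d; apply: hJ.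
have valE d : (iter d (@ordS n) j = (j + d) %% n :> nat)%N.
  elim: d => [|d IH] /=; first by rewrite addn0 modn_small.
  by rewrite IH -addn1 modnDml addn1 addnS.
have -> : i = iter (n - j + i) (@ordS n) j; last exact: iterJ.
by apply/val_inj/esym; rewrite [LHS]valE addnA subnKC ?modnDl ?modn_small // ltnW.
Qed.

(* Counting: a nonempty proper set of triangles covers at least one pole and
   one more equatorial vertex than it has members. *)
Lemma bipyramid_hypertree : hypertree (bipyramid v).
Proof.
split.
- by move=> A; rewrite bipyramidE => /imsetP[i _ ->]; rewrite card_T.
- have two i j x : i != j -> x \in T i -> x \in T j -> exists A B,
      [/\ A \in bipyramid v, B \in bipyramid v, A != B, x \in A & x \in B].
    move=> ij xi xj; exists (T i), (T j).
    by split=> //; rewrite ?(inj_eq T_inj) // bipyramidE imset_f.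
  move=> x; case: (labelP x) => [[j]|->|->].
  + have [i ->] := vP j; move->; apply: (two i (ord_pred i)).
    * by apply/eqP => e; have := ordS_neq (ord_pred i); rewrite ord_predK -e eqxx.
    * by rewrite pt_in_T eqxx.
    * by rewrite pt_in_T ord_predK eqxx orbT.
  + by apply: (two i0 i2); rewrite // pole1_in_T.
  + by apply: (two i1 i3); rewrite // pole2_in_T.
- move=> S sS S0; rewrite sum_T //.
  pose J := [set i | T i \in S]%SET.
  have SE : S = [set T i | i in J]%SET.
    apply/setP => A; apply/idP/imsetP => [AS|[i]]; last first.
      by rewrite finset.inE => h ->.
    have := fintype.subsetP sS _ AS; rewrite bipyramidE => /imsetP[i _ eA].
    by exists i; rewrite // finset.inE -eA.
  have cardJ : #|S| = #|J| by rewrite SE card_imset.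
  have covP i x : i \in J -> x \in T i -> x \in finset.cover S.
    by rewrite finset.inE => iS xi; apply/bigcupP; exists (T i).
  have J0 : J != finset.set0.
    have /set0Pn[A] := S0; rewrite SE => /imsetP[i iJ _].
    by apply/set0Pn; exists i.
  have inj_ptv : injective (@pt n \o v) by apply: inj_comp.
  have [full|] := boolP [forall i, (i \in J) ==> (ordS i \in J)].
    have {full} JT : forall i, i \in J.
      by apply: ordS_closed => // i iJ; have /forallP/(_ i) := full; rewrite iJ.
    have -> : finset.cover S = finset.setT.
      apply/setP => x; rewrite [RHS]finset.inE; case: (labelP x) => [[j]|->|->].
      + have [i ->] := vP j; move->; apply: (covP i) => //.
        by rewrite pt_in_T eqxx.
      + by apply: (covP i0); rewrite // pole1_in_T.
      + by apply: (covP i1); rewrite // pole2_in_T.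
    by rewrite cardsT card_ord cardJ addn2 !ltnS -[leqRHS](card_ord n) max_card.
  rewrite negb_forall => /existsP[i]; rewrite negb_imply => /andP[iJ SiJ].
  pose P := if odd i then pole2 n else pole1 n.
  pose U := (P |: (pt (v (ordS i)) |: [set pt (v j) | j in J]))%SET.
  have cardU : #|U| = (#|S| + 2)%N.
    rewrite /U !cardsU1 (card_imset _ inj_ptv) cardJ !finset.inE.
    rewrite (mem_imset _ _ inj_ptv) SiJ [P == _]eq_sym.
    have -> : (pt (v (ordS i)) == P) = false.
      by rewrite /P; case: odd; rewrite ?pt_neq1 ?pt_neq2.
    have -> /= : (P \in [set pt (v j) | j in J]%SET) = false.
      apply/negP => /imsetP[j _ /esym/eqP]; rewrite /P.
      by case: odd; rewrite ?pt_neq1 ?pt_neq2.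
    by rewrite addnA addnC.
  rewrite -cardU; apply/subset_leq_card/fintype.subsetP => x.
  rewrite !finset.inE => /or3P[/eqP->|/eqP->|/imsetP[j jJ ->]].
  + by apply: (covP i) => //; rewrite in_T eqxx !orbT.
  + by apply: (covP i) => //; rewrite pt_in_T eqxx orbT.
  + by apply: (covP j) => //; rewrite pt_in_T eqxx.
- by rewrite sum_T // bipyramidE card_imset // !card_ord addn2.
Qed.

End BipyramidHypertree.

Definition ones_minus_ones (k : nat) (i : 'I_(2 * k)) : int :=
  if (i < k)%N then 1 else -1.

(* Main.v *)
Require Import Defs.
From mathcomp Require Import all_boot all_order all_algebra.
From mathcomp Require Import generic_quotient finmap.
From mathcomp Require Import boolp classical_sets filter topology.
From mathcomp Require Import ring zify.
Set Implicit Arguments.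
Unset Strict Implicit.
Unset Printing Implicit Defensive.
Import Defs GRing.Theory.
Local Open Scope ring_scope.
Local Open Scope quotient_scope.
Local Open Scope classical_set_scope.

(** Put the poles at infinity in two directions of the affine plane.  A closed
    polygon whose sides are alternately horizontal and vertical has vertices
    [(x_i, y_i)] where [y] is constant along every other side and [x] along the
    remaining ones; projecting from the origin sends the poles to [1 : 0] and
    [0 : 1] and the vertices to [x_i : y_i], so that the alternating product of
    the ratios [x_i / y_i] is [1].  This is the condition for
    [prod (z - p_i) / prod (z - p_j)], with [i] odd and [j] even, to take the same
    value at the two poles, that is, for the divisor to be trivial on the nodal
    curve.  Conversely such ratios determine the polygon up to scaling.  It may
    have superfluous collinearities, but moving the lines along a suitable
    polynomial curve removes them for almost all values of the parameter, so that
    the planar configurations are dense in the locus where the product is [1].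

    On the Chen-Coskun side one has to see that closing up in the space of genus
    one curves adds nothing over [M0].  The clutching map identifies smooth curves
    only by exchanging the poles, so the image of the complement in [M0] of the
    balanced locus is open; that [M0] is open is seen on the cross-ratios, one of
    which degenerates on any reducible tree. *)

(** * Brackets and projective equivalence *)

Lemma det_mx2 (R : comNzRingType) (M : 'M[R]_2) :
  \det M = M ord0 ord0 * M ord_max ord_max - M ord0 ord_max * M ord_max ord0.
Proof.
rewrite (expand_det_row _ ord0) !big_ord_recl big_ord0 addr0 /cofactor !det_mx11 !mxE /=.
have e1 : lift ord0 ord0 = ord_max :> 'I_2 by apply/val_inj.
have e2 : lift (lift ord0 ord0) 0 = ord0 :> 'I_2 by apply/val_inj.
by rewrite e2 e1 /bump /= expr0 expr1 mul1r mulN1r mulrN.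
Qed.

Lemma det_mx3 (R : comNzRingType) (m : nat -> nat -> R) :
  \det (\matrix_(i < 3, j < 3) m i j) =
  m 0%N 0%N * (m 1%N 1%N * m 2%N 2%N - m 1%N 2%N * m 2%N 1%N)
  - m 0%N 1%N * (m 1%N 0%N * m 2%N 2%N - m 1%N 2%N * m 2%N 0%N)
  + m 0%N 2%N * (m 1%N 0%N * m 2%N 1%N - m 1%N 1%N * m 2%N 0%N).
Proof.
rewrite (expand_det_row _ ord0) !big_ord_recl big_ord0 addr0 /cofactor !det_mx2.
rewrite !mxE /= /bump /= ?addn0 ?add0n ?addn1; ring.
Qed.

(** Over any commutative ring, so that it serves for polynomial coordinates and for their values
    alike. *)
Definition br (R : comNzRingType) (w w' : R * R) : R := w.1 * w'.2 - w'.1 * w.2.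

Definition hxy (K : fieldType) (p : P1 K) : K * K := (hx p, hy p).

Section Brackets.
Variable K : fieldType.
Implicit Types (p q : P1 K) (w : K * K).

Lemma bracket_eq0 p q : (bracket p q == 0) = (p == q).
Proof.
case: p q => [x|] [y|]; rewrite /bracket /= ?mulr1 ?mulr0 ?mul1r ?mul0r ?subr0 ?sub0r
  ?oppr_eq0 ?oner_eq0 ?eqxx //.
by rewrite subr_eq0; apply/eqP/eqP => [->|[->]].
Qed.

Lemma br_hv_eq0 p q : (br (hxy p) (hxy q) == 0) = (p == q).
Proof. exact: bracket_eq0. Qed.

Lemma br_swap (R : comNzRingType) (w w' : R * R) : br w w' = - br w' w.
Proof. by rewrite /br opprB mulrC [w'.1 * _]mulrC. Qed.

Lemma hv_ratio w : (w.1 != 0) || (w.2 != 0) ->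
  exists2 c : K, c != 0 & w = (c * hx (ratio w.1 w.2), c * hy (ratio w.1 w.2)).
Proof.
move=> /hxhy_ratio[c c0 [e1 e2]]; exists c => //.
by rewrite -e1 -e2; case: w {e1 e2}.
Qed.

(** The effect on brackets of a common linear change of coordinates, with determinant [e], and of
    rescaling each vector by [c i]. Equations whose two sides have equal degree in each vector are
    insensitive to it. *)
Definition pequiv (I : Type) (W W' : I -> K * K) : Prop :=
  exists (e : K) (c : I -> K), [/\ e != 0, forall i, c i != 0 &
    forall i j, br (W i) (W j) = e * (c i * c j) * br (W' i) (W' j)].

Lemma pequiv_comp (I J : Type) (h : J -> I) (W W' : I -> K * K) :
  pequiv W W' -> pequiv (W \o h) (W' \o h).
Proof.
by case=> e [c [e0 c0 eW]]; exists e, (c \o h); split=> [|i|i j] /=.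
Qed.

Lemma pequiv_mobius (I : Type) (M : 'M[K]_2) (p : I -> P1 K) : M \in unitmx ->
  pequiv (fun i => hxy (mobius M (p i))) (fun i => hxy (p i)).
Proof.
move=> uM; have nz i := mobius_nondeg uM (hxhy_neq0 (p i)).
have /choice[c cP] : forall i, exists c : K, c != 0 /\
    (M ord0 ord0 * hx (p i) + M ord0 ord_max * hy (p i),
     M ord_max ord0 * hx (p i) + M ord_max ord_max * hy (p i)) =
    (c * hx (mobius M (p i)), c * hy (mobius M (p i))).
  by move=> i; have [c c0 e] := @hv_ratio (_, _) (nz i); exists c.
exists (\det M), (fun i => (c i)^-1); split.
- by rewrite unitmxE unitfE in uM.
- by move=> i; rewrite invr_eq0; case: (cP i).
move=> i j; have [ci [ei1 ei2]] := cP i; have [cj [ej1 ej2]] := cP j.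
rewrite /br /=.
rewrite det_mx2.
apply: (mulfI (mulf_neq0 ci cj)).
transitivity ((c i * hx (mobius M (p i))) * (c j * hy (mobius M (p j))) -
  (c j * hx (mobius M (p j))) * (c i * hy (mobius M (p i)))); first by ring.
by rewrite -ei1 -ei2 -ej1 -ej2; field; apply/andP.
Qed.

Lemma pequiv_ratio (I : Type) (W : I -> K * K) :
  (forall i, ((W i).1 != 0) || ((W i).2 != 0)) ->
  pequiv W (fun i => hxy (ratio (W i).1 (W i).2)).
Proof.
move=> nz; have /choice[c cP] : forall i, exists c : K, c != 0 /\
    W i = (c * hx (ratio (W i).1 (W i).2), c * hy (ratio (W i).1 (W i).2)).
  by move=> i; have [c c0 e] := hv_ratio (nz i); exists c.
exists 1, c; split; first exact: oner_neq0.
  by move=> i; case: (cP i).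
move=> i j; have [_ ei] := cP i; have [_ ej] := cP j.
by rewrite {1}ei {1}ej /br /=; ring.
Qed.

Lemma pequiv_sym (I : Type) (W W' : I -> K * K) : pequiv W W' -> pequiv W' W.
Proof.
case=> e [c [e0 c0 eW]]; exists e^-1, (fun i => (c i)^-1).
split=> [|i|i j]; rewrite ?invr_eq0 ?c0 //.
by rewrite eW; field; rewrite e0 !c0.
Qed.

End Brackets.

(** * Cross-ratios on irreducible curves *)

Section CrossRatios.
Variable m : nat.

Definition crn (R : comNzRingType) (W : 'I_m -> R * R) (t : quad m) : R :=
  let r j := W (tnth (val t) j) in
  br (r (inord 0)) (r (inord 2)) * br (r (inord 1)) (r (inord 3)).

Definition crd (R : comNzRingType) (W : 'I_m -> R * R) (t : quad m) : R :=
  let r j := W (tnth (val t) j) in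
  br (r (inord 0)) (r (inord 3)) * br (r (inord 1)) (r (inord 2)).

Variable K : fieldType.
Implicit Type C : curve K m.

Lemma ord_eq1 N (u v : 'I_N) : N = 1%N -> u = v.
Proof. by move=> N1; move: u v; rewrite N1 => u v; rewrite !ord1. Qed.

Lemma pos_inj C : ncomp C = 1%N -> injective (pos C).
Proof.
move=> C1 i j e; suff [] : inl i = inl j :> 'I_m + 'I_(nnode C) * bool by [].
apply: (@special_inj _ _ C); rewrite [LHS]surjective_pairing [RHS]surjective_pairing.
by congr (_, _) => //; apply: ord_eq1.
Qed.

Lemma tnth_quad_neq (t : quad m) (a b : nat) : (a < 4)%N -> (b < 4)%N -> a != b ->
  tnth (val t) (inord a) != tnth (val t) (inord b).
Proof.
move=> a4 b4; apply: contraNneq => e.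
have /tuple_uniqP h := valP t; have := h _ _ e => /(congr1 val) /=.
by rewrite !inordK // => ->.
Qed.

Lemma cross_ratio_irr C (W : 'I_m -> K * K) t : ncomp C = 1%N ->
  pequiv W (fun i => hxy (pos C i)) -> cross_ratio C t = ratio (crn W t) (crd W t).
Proof.
move=> C1 [e [c [e0 c0 eW]]].
have ret (v : 'I_(ncomp C)) i : retract v i = pos C i.
  by rewrite /retract (ord_eq1 (comp _) v C1) eqxx.
have num (v : 'I_(ncomp C)) : cross_num t v = crn (fun i => hxy (pos C i)) t.
  by rewrite /cross_num !ret.
have den (v : 'I_(ncomp C)) : cross_den t v = crd (fun i => hxy (pos C i)) t.
  by rewrite /cross_den !ret.
have nz : crn (fun i => hxy (pos C i)) t != 0.
  by rewrite mulf_neq0 // br_hv_eq0 (inj_eq (pos_inj C1)) tnth_quad_neq.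
rewrite /cross_ratio; case: pickP => [v _|]; last first.
  have v : 'I_(ncomp C) by rewrite C1; exact: ord0.
  by move/(_ v); rewrite num nz.
rewrite num den /crn /crd !eW.
set c0' := c _; set c1 := c _; set c2 := c _; set c3 := c _.
(* Numerator and denominator contain each of the four vectors once, so both are rescaled by the same
   factor. *)
rewrite -(@ratio_scale _ (e ^+ 2 * (c0' * c1 * c2 * c3))).
  by congr ratio; rewrite -/c0' -/c1; ring.
by rewrite !mulf_neq0 ?expf_neq0 ?c0.
Qed.

End CrossRatios.

(** * The balance condition *)

Section Balanced.
Variable k : nat.

(** Let [f] be the product of the linear forms vanishing at the first [k] points, divided by that
    for the other [k]. This is the equality of the values of [f] at the two poles, cleared of
    denominators. *)
Definition balanced (R : comNzRingType) (W : 'I_(2 * k) + bool -> R * R) : Prop :=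
  \prod_(i < 2 * k) br (W (inr (i < k)%N)) (W (inl i)) =
  \prod_(i < 2 * k) br (W (inr (~~ (i < k)%N))) (W (inl i)).

Lemma big_half (T : Type) (idx : T) (op : Monoid.com_law idx) (F : bool -> T) :
  \big[op/idx]_(i < 2 * k) F (i < k)%N = \big[op/idx]_(i < 2 * k) F (~~ (i < k)%N).
Proof.
rewrite [LHS](reindex_inj rev_ord_inj) /=; apply: eq_bigr => i _.
by congr F; have := ltn_ord i; lia.
Qed.

(** Each side contains every marked point once and each pole [k] times, the two halves having equal
    size, so both are rescaled alike. *)
Lemma pequiv_balanced (K : fieldType) (W W' : 'I_(2 * k) + bool -> K * K) :
  pequiv W W' -> balanced W -> balanced W'.
Proof.
case=> e [c [e0 c0 eW]]; rewrite /balanced.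
under eq_bigr do rewrite eW; under [in RHS]eq_bigr do rewrite eW.
rewrite !big_split /= (big_half _ (fun b => c (inr b))).
by apply: mulfI; do ?apply: mulf_neq0; apply/prodf_neq0 => i _.
Qed.

Lemma balanced_swap (K : fieldType) (W : 'I_(2 * k) + bool -> K * K) :
  balanced W ->
  balanced (fun x => W (match x with inl i => inl i | inr b => inr (~~ b) end)).
Proof.
rewrite /balanced /= => <-.
by apply: eq_bigr => i _; rewrite negbK.
Qed.

End Balanced.

Section NodeBalanced.
Variables (K : fieldType) (k : nat).
Implicit Types C D : curve K (2 * k).

Definition node_config C (e : 'I_(nnode C)) (x : 'I_(2 * k) + bool) : K * K :=
  hxy (match x with inl i => pos C i | inr b => (special (c := C) (inr (e, b))).2 end).

Definition node_balanced C : Prop := forall e, balanced (@node_config C e).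

Lemma iso_ncomp m (C D : curve K m) : iso C D -> ncomp C = ncomp D.
Proof.
by case=> s [M] [t] [bs _ _ _ _]; rewrite -(card_ord (ncomp C)) (bij_eq_card bs) card_ord.
Qed.

(** A Möbius map relates the two normalizations. It changes brackets only by rescaling, but may
    exchange the branches of the node, which swaps the two sides of the equation. *)
Lemma iso_node_balanced C D : ncomp C = 1%N -> iso C D ->
  node_balanced C -> node_balanced D.
Proof.
move=> C1 [s] [M] [t] [bs [t' tK t'K] uM tf [h1 h2]] bC e.
have v : 'I_(ncomp C) by rewrite C1; exact: ord0.
have posD i : pos D i = mobius (M v) (pos C i).
  rewrite /pos h1; case E: special => [w p] /=; by rewrite (ord_eq1 w v C1).
have brD x : (special (c := D) (inr (t x))).2 =
             mobius (M v) (special (c := C) (inr x)).2.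
  by rewrite h2; case E: special => [w p] /=; rewrite (ord_eq1 w v C1).
(* The bit [b0] records whether the branches are exchanged. *)
case ee: (t' (e, false)) => [e0 b0].
have et b : t (e0, b (+) b0) = (e, b).
  case: b => /=; last by rewrite -ee t'K.
  have -> : (e0, ~~ b0) = flip (e0, b0) by [].
  by rewrite tf -ee t'K.
pose p x := match x with inl i => pos C i
  | inr b => (special (c := C) (inr (e0, b (+) b0))).2 end.
have -> : node_config e = (fun x => hxy (mobius (M v) (p x))).
  by apply/funext => -[i|b]; rewrite /node_config /= ?posD // -et brD.
apply: pequiv_balanced (pequiv_sym (pequiv_mobius p (uM v))) _.
have := bC e0; rewrite {}/p; case: b0 {ee et} => [/balanced_swap|]; congr balanced.
  by apply/funext => -[//|b]; rewrite /node_config addbT.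
by apply/funext => -[//|b]; rewrite /node_config addbF.
Qed.

End NodeBalanced.

(** * Reducible curves and the Zariski topology *)

Section ReducibleCurves.
Variables (K : fieldType) (m : nat).
Implicit Type C : curve K m.

Definition valence C (v : 'I_(ncomp C)) : nat :=
  #|[pred x : 'I_(nnode C) * bool | comp (C := C) (inr x) == v]|.

Lemma special_count C (v : 'I_(ncomp C)) :
  #|[pred x | comp (C := C) x == v]| =
  (#|[pred i | comp (C := C) (inl i) == v]| + valence v)%N.
Proof. by rewrite /valence -!sum1_card big_sumType. Qed.

Lemma sum_valence C : (\sum_(v < ncomp C) valence v)%N = (2 * nnode C)%N.
Proof.
rewrite mulnC -[nnode C]card_ord -card_bool -card_prod -sum1_card.
rewrite (partition_big (fun x => comp (C := C) (inr x)) predT) //=.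
by apply: eq_bigr => v _; rewrite /valence -sum1_card.
Qed.

(** A path to another component must leave [v] through a node. *)
Lemma valence_gt0 C (v : 'I_(ncomp C)) : stable 0 C -> (1 < ncomp C)%N ->
  (0 < valence v)%N.
Proof.
case/and4P => _ /forallP/(_ v)/forallP con _ _ gt1.
have [w wv] : exists w, w != v.
  have : (1 < #|'I_(ncomp C)|)%N by rewrite card_ord.
  case/card_gt1P => x [y] [_ _ xy].
  by case: (eqVneq x v) => [e|]; [exists y; rewrite -e eq_sym | exists x].
have /connectP[[|u p] /= pth e] := con w; first by rewrite e eqxx in wv.
case/andP: pth => /existsP[x /andP[xv _]] _.
by apply/card_gt0P; exists x.
Qed.

(** A tree has one node fewer than components, so the valences add up to twice [ncomp C] minus 2; as
    each is at least 1, at least two of them equal 1. *)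
Lemma two_leaves C : stable 0 C -> (1 < ncomp C)%N ->
  exists u w : 'I_(ncomp C), [/\ valence u = 1%N, valence w = 1%N & u != w].
Proof.
move=> st gt1; have [_ _ /eqP gC _] := and4P st.
pose J := [pred v : 'I_(ncomp C) | valence v == 1%N].
suff /card_gt1P[u [w [/eqP u1 /eqP w1 uw]]] : (1 < #|J|)%N by exists u, w.
have : (\sum_(v < ncomp C) 2 <= \sum_(v < ncomp C) valence v + #|J|)%N.
  rewrite -sum1_card [X in (_ + X)%N]big_mkcond /= -big_split /=.
  apply: leq_sum => v _; have := valence_gt0 v st gt1; rewrite inE.
  by case: eqP => [->|]; lia.
by rewrite sum_valence sum_nat_const card_ord; lia.
Qed.

(** Stability requires three special points on the leaf, only one of which is a branch of a node. *)
Lemma leaf_marks C (u : 'I_(ncomp C)) : stable 0 C -> valence u = 1%N ->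
  exists i j : 'I_m, [/\ i != j, comp (C := C) (inl i) = u & comp (C := C) (inl j) = u].
Proof.
case/and4P => _ _ _ /forallP/(_ u); rewrite special_count => + u1; rewrite u1 addn1 ltnS.
by case/card_gt1P => i [j] [/eqP iu /eqP ju ij]; exists i, j.
Qed.

Lemma retract_eq C (v : 'I_(ncomp C)) i j :
  comp (C := C) (inl i) = comp (C := C) (inl j) -> comp (C := C) (inl i) != v ->
  retract v i = retract v j.
Proof. by move=> e iv; rewrite /retract -e (negbTE iv). Qed.

Lemma tnth_inord (T : Type) (t : 4.-tuple T) x0 (a : nat) : (a < 4)%N ->
  tnth t (inord a) = nth x0 t a.
Proof. by move=> a4; rewrite (tnth_nth x0) inordK. Qed.

(* Two marked points on each of two leaves: wherever the leaves are not, each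
   pair is contracted to a single point. *)
Lemma reducible_cross_num C : stable 0 C -> (1 < ncomp C)%N ->
  exists t : quad m, forall v : 'I_(ncomp C), cross_num t v = 0.
Proof.
move=> st gt1; have [u [w [u1 w1 uw]]] := two_leaves st gt1.
have [i [j [ij iu ju]]] := leaf_marks st u1.
have [a [b [ab aw bw]]] := leaf_marks st w1.
have neq x y : comp (C := C) (inl x) = u -> comp (C := C) (inl y) = w -> x != y.
  by move=> xu yw; apply: contraNneq uw => xy; rewrite -xu -yw xy.
(* The two pairs are interleaved because [cross_num] brackets entry 0 with entry 2 and entry 1 with
   entry 3. *)
have uq : uniq [tuple i; a; j; b].
  rewrite /= !inE !negb_or ij ab !(neq i) //= (eq_sym a) (neq j) // (neq j) //.
exists (exist (fun t : 4.-tuple 'I_m => is_true (uniq t)) _ uq) => v.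
rewrite /cross_num /= !(tnth_inord _ i) //=.
case: (eqVneq u v) => [uv|uv].
  rewrite [X in _ * X]/bracket (@retract_eq C v a b) ?subrr ?mulr0 ?aw ?bw //.
  by rewrite -uv eq_sym.
by rewrite [X in X * _]/bracket (@retract_eq C v i j) ?subrr ?mul0r ?iu ?ju.
Qed.

End ReducibleCurves.

Section Topology.
Variables (K : fieldType) (m : nat).

Lemma mhomog_ext (I : eqType) (d d' : I -> nat) (f f' : (I -> P1 K) -> K) :
  mhomog d f -> d =1 d' -> f =1 f' -> mhomog d' f'.
Proof. by move=> h /funext <- /funext <-. Qed.

Lemma mhomog_prod (I : eqType) (J : Type) (r : seq J) (P : pred J) (d : J -> I -> nat)
    (f : J -> (I -> P1 K) -> K) : (forall j, mhomog (d j) (f j)) ->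
  mhomog (fun i => \sum_(j <- r | P j) d j i)%N (fun z => \prod_(j <- r | P j) f j z).
Proof.
move=> h; elim: r => [|j r IH].
  by apply: mhomog_ext (mhomog_const _ 1) _ _ => ?; rewrite big_nil.
case Pj: (P j); last first.
  by apply: mhomog_ext IH _ _ => ?; rewrite big_cons Pj.
by apply: mhomog_ext (mhomog_mul (h j) IH) _ _ => ?; rewrite big_cons Pj.
Qed.

Lemma mhomog_sub (I : eqType) (d : I -> nat) (f g : (I -> P1 K) -> K) :
  mhomog d f -> mhomog d g -> mhomog d (fun z => f z - g z).
Proof.
move=> hf hg; apply: mhomog_add => //.
by apply: mhomog_ext (mhomog_mul (mhomog_const _ (-1)) hg) _ _ => ?; rewrite ?mulN1r.
Qed.

Lemma Mbar0_openE (A : set (Mbar0 K m)) :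
  open A = exists2 D', D' `<=` finI_from (@Mbar0_subbase K m) id & \bigcup_(U in D') U = A.
Proof. by []. Qed.

Lemma Mbar0_open_subbase (d : quad m -> nat) f : mhomog d f ->
  open [set x : Mbar0 K m | f (cross_ratio (repr x : scurve K 0 m)) != 0].
Proof.
move=> hf; rewrite Mbar0_openE; set U := [set x | _].
exists [set U]; last by rewrite bigcup_set1.
by move=> _ ->; apply: (@finI_from1 _ _ _ id U); exists d, f.
Qed.

Lemma M0P (x : Mbar0 K m) : M0 x <-> ncomp (repr x : scurve K 0 m) = 1%N.
Proof.
split=> [[C -> C1]|x1]; last by exists (repr x); rewrite ?reprK.
rewrite -C1; apply/iso_ncomp/(Mrat_eqP (repr (\pi_(Mbar0 K m) C)) C).
exact: reprK.
Qed.

Lemma hxy_cross_irr (C : curve K m) t : ncomp C = 1%N ->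
  let W i := hxy (pos C i) in
  [/\ crn W t != 0, crd W t != 0 & cross_ratio C t = Some (crn W t / crd W t)].
Proof.
move=> C1 W.
have nz : crn W t != 0 by rewrite mulf_neq0 // br_hv_eq0 (inj_eq (pos_inj C1)) tnth_quad_neq.
have nz' : crd W t != 0 by rewrite mulf_neq0 // br_hv_eq0 (inj_eq (pos_inj C1)) tnth_quad_neq.
split=> //; rewrite (cross_ratio_irr (W := W) _ C1) /ratio ?(negbTE nz') //.
by exists 1, (fun=> 1); split=> [||i j]; rewrite ?oner_neq0 // !mul1r.
Qed.

Lemma cross_ratio_scale (C : curve K m) (W : 'I_m -> K * K) t : ncomp C = 1%N ->
  pequiv W (fun i => hxy (pos C i)) -> exists e : K, e != 0 /\
  (crn W t = e * hx (cross_ratio C t) /\ crd W t = e * hy (cross_ratio C t)).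
Proof.
move=> C1 WC; rewrite (cross_ratio_irr t C1 WC).
have [|e e0 [e1 e2]] := @hv_ratio _ (crn W t, crd W t); last by exists e.
apply/orP; left; have [e [c [e0 c0 eW]]] := WC.
by rewrite /= /crn !eW !mulf_neq0 ?br_hv_eq0 ?(inj_eq (pos_inj C1)) ?tnth_quad_neq.
Qed.

Lemma cross_ratio_iso (C D : curve K m) t : ncomp C = 1%N -> iso C D ->
  cross_ratio C t = cross_ratio D t.
Proof.
move=> C1 CD; have D1 : ncomp D = 1%N by rewrite -(iso_ncomp CD).
have [s [M] [_] [_ _ uM _ [h _]]] := CD.
have v : 'I_(ncomp C) by rewrite C1; exact: ord0.
have posD i : pos D i = mobius (M v) (pos C i).
  by rewrite /pos h; case E: special => [w p] /=; rewrite (ord_eq1 w v C1).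
have e : (fun i => hxy (pos D i)) = (fun i => hxy (mobius (M v) (pos C i))).
  by apply/funext => i; rewrite posD.
rewrite (cross_ratio_irr (W := fun i => hxy (pos D i)) _ C1); last first.
  by rewrite e; apply: pequiv_mobius.
rewrite (cross_ratio_irr (W := fun i => hxy (pos D i)) _ D1) //.
by exists 1, (fun=> 1); split=> [||i j]; rewrite ?oner_neq0 // !mul1r.
Qed.

(** On an irreducible curve no cross-ratio is 0 or infinity, whereas on a reducible tree some
    cross-ratio is one of them; so [M0] is the nonvanishing locus of one multihomogeneous form. *)
Lemma open_M0 : open (@M0 K m).
Proof.
have -> : @M0 K m = [set x | \prod_(t : quad m) (hx (cross_ratio (repr x : scurve K 0 m) t) *
    hy (cross_ratio (repr x : scurve K 0 m) t)) != 0].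
  apply/seteqP; split => x /=; rewrite M0P.
    move=> x1; apply/prodf_neq0 => t _; have [n0 d0 ->] := hxy_cross_irr t x1.
    by rewrite mulr1 mulf_neq0 ?invr_eq0.
  have st := curve_of_stable (repr x : scurve K 0 m).
  move=> /prodf_neq0 h; apply/eqP; rewrite eqn_leq; have [-> _ _ _] := and4P st.
  rewrite andbT leqNgt; apply/negP => /(reducible_cross_num st)[t tP].
  (* If no component is picked, the default value [None] has [hy] zero; otherwise the vanishing
     numerator makes [hx] zero. *)
  have := h t isT; rewrite /cross_ratio; case: pickP => [v|_]; last by rewrite mulr0 eqxx.
  by rewrite tP eqxx /= /ratio => /negbTE->; rewrite mul0r /= mul0r eqxx.
pose f z : K := \prod_(t : quad m) (hx (z t) * hy (z t)).
apply: (@Mbar0_open_subbase _ f); apply: mhomog_prod => t.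
exact: mhomog_mul (mhomog_x _ t) (mhomog_y _ t).
Qed.

End Topology.

(** * The balanced locus *)

Section Labels.
Variable n : nat.

(** The pole [b] becomes the branch [b] of the node created by [glue]. *)
Definition label (x : 'I_n + bool) : 'I_n.+2 :=
  match x with inl i => pt i | inr b => if b then pole2 n else pole1 n end.

Lemma label_inj : injective label.
Proof.
pose h (x : 'I_n + bool) : 'I_n + 'I_1 * bool :=
  match x with inl i => inl i | inr b => inr (ord_max, b) end.
have e x : inl (label x) = glue_label (h x) by case: x => //= b; rewrite unlift_none.
move=> x y xy; have /glue_label_inj : glue_label (h x) = glue_label (h y) by rewrite -!e xy.
by case: x y {xy} => [i|b] [j|c] //= [->].
Qed.

End Labels.

Section BalancedLocus.
Variables (K : fieldType) (k : nat).

Lemma stable0_nnode m (C : curve K m) : stable 0 C -> ncomp C = 1%N -> nnode C = 0%N.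
Proof. by case/and4P => _ _ /eqP e _ C1; lia. Qed.

Lemma glue_node_balanced (C : curve K (2 * k).+2) : nnode C = 0%N ->
  node_balanced (glue C) <-> balanced (fun x => hxy (pos C (label x))).
Proof.
move=> N0; have e0 : @node_config _ _ (glue C) ord_max = fun x => hxy (pos C (label x)).
  by apply/funext => -[//|b]; rewrite /node_config /= unlift_none.
split=> [/(_ ord_max)|h e]; first by rewrite e0.
by rewrite (ord_eq1 e ord_max) /= ?N0 // e0.
Qed.

(** Phrased on the glued curve, to be comparable with the image under [clutch]. *)
Definition balanced_locus : set (Mbar0 K (2 * k).+2) :=
  [set x | M0 x /\ node_balanced (glue (repr x : scurve K 0 (2 * k).+2))].

Lemma balanced_locus_pi (C : scurve K 0 (2 * k).+2) : ncomp C = 1%N ->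
  balanced_locus (\pi_(Mbar0 K _) C) <-> balanced (fun x => hxy (pos C (label x))).
Proof.
move=> C1; rewrite -glue_node_balanced ?(stable0_nnode _ C1) ?curve_of_stable //.
set D := repr (\pi_(Mbar0 K _) C) : scurve K 0 _.
have CD : iso C D by apply/(Mrat_eqP C D)/esym/(reprK (\pi_(Mbar0 K _) C)).
split=> [[_ b]|b].
  by apply: iso_node_balanced (iso_sym (glue_iso CD)) b; rewrite /= -(iso_ncomp CD).
split; first by exists C.
by apply: iso_node_balanced (glue_iso CD) b.
Qed.

Variable v : 'I_(2 * k) -> 'I_(2 * k).
Hypothesis hv_alt : alternating v.

Lemma odd_ordS (i : 'I_(2 * k)) : odd (ordS i) = ~~ odd i.
Proof.
have := ltn_ord i; rewrite leq_eqVlt => /orP[/eqP e|lt_i] /=.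
  by rewrite e modnn -[odd i]negbK -oddS e oddM.
by rewrite modn_small.
Qed.

Lemma prod_odd_ordS (R : comNzRingType) (G : 'I_(2 * k) -> R) :
  \prod_(i < 2 * k | odd i) G i = \prod_(i < 2 * k | ~~ odd i) G (ordS i).
Proof.
rewrite (reindex_inj (can_inj (@ordSK _))); apply: eq_bigl => i.
by rewrite odd_ordS.
Qed.

Lemma prod_even_ordS (R : comNzRingType) (G : 'I_(2 * k) -> R) :
  \prod_(i < 2 * k | ~~ odd i) G i = \prod_(i < 2 * k | odd i) G (ordS i).
Proof.
rewrite (reindex_inj (can_inj (@ordSK _))); apply: eq_bigl => i.
by rewrite odd_ordS negbK.
Qed.

(** Pairs each equatorial vertex of even index, whose label lies in the first half, with its
    successor, whose label lies in the second. *)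
Lemma prod_alternating (R : comNzRingType) (F : bool -> 'I_(2 * k) -> R) :
  \prod_(i < 2 * k) F (i < k)%N i =
  \prod_(i < 2 * k | ~~ odd i) (F true (v i) * F false (v (ordS i))).
Proof.
have [v_inj v_alt] := hv_alt; rewrite (reindex_inj v_inj) (bigID (fun i => ~~ odd (val i))) /=.
rewrite big_split /=; congr (_ * _).
  by apply: eq_bigr => i ev; rewrite v_alt ev.
under eq_bigl do rewrite negbK.
by rewrite -(prod_odd_ordS (fun j => F false (v j))); apply: eq_bigr => i oi; rewrite v_alt oi.
Qed.

(** The factors are the numerators and denominators of the cross-ratios of the two poles with the
    ends of every other edge of the equator. *)
Lemma balanced_alternating (R : comNzRingType) (W : 'I_(2 * k) + bool -> R * R) :
  balanced W <->
  \prod_(i < 2 * k | ~~ odd i)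
     (br (W (inr false)) (W (inl (v i))) * br (W (inr true)) (W (inl (v (ordS i))))) =
  \prod_(i < 2 * k | ~~ odd i)
     (br (W (inr false)) (W (inl (v (ordS i)))) * br (W (inr true)) (W (inl (v i)))).
Proof.
rewrite /balanced (prod_alternating (fun b i => br (W (inr b)) (W (inl i)))).
rewrite (prod_alternating (fun b i => br (W (inr (~~ b))) (W (inl i)))) /=.
under [X in X = _ <-> _]eq_bigr do rewrite mulrC.
by split=> ->.
Qed.

Lemma edge_quad_subproof (i : 'I_(2 * k)) :
  uniq [tuple label (inr false); label (inr true); label (inl (v i)); label (inl (v (ordS i)))].
Proof.
rewrite -[X in uniq X]/(map (@label _)
  [:: inr false; inr true; inl (v i); inl (v (ordS i))]).
rewrite (map_inj_uniq (@label_inj _)) /= !inE -!sum_eqE /= (inj_eq hv_alt.1) ?andbT.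
by apply/eqP => e; have := odd_ordS i; rewrite -e; case: odd.
Qed.

Definition edge_quad i : quad (2 * k).+2 :=
  exist (fun t : 4.-tuple 'I_(2 * k).+2 => is_true (uniq t)) _ (edge_quad_subproof i).

(** On [M0] balance means that the cross-ratios of the [edge_quad i], over even [i], have product 1.
    Homogenized, this is the vanishing of a difference of two products of the same multidegree. *)
Lemma open_unbalanced : open (@M0 K (2 * k).+2 `\` balanced_locus).
Proof.
pose f z : K := \prod_(i < 2 * k | ~~ odd i) hx (z (edge_quad i)) -
                \prod_(i < 2 * k | ~~ odd i) hy (z (edge_quad i)).
have -> : @M0 K (2 * k).+2 `\` balanced_locus =
    @M0 K (2 * k).+2 `&` [set x | f (cross_ratio (repr x : scurve K 0 _)) != 0].
  apply/seteqP; rewrite -[X in X /\ _]/(forall x, _) -[X in _ /\ X]/(forall x, _).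
  suff e x : M0 x -> balanced_locus x <-> f (cross_ratio (repr x : scurve K 0 _)) = 0.
    split=> x [x0 h]; split=> //; first by apply/eqP => /(e x x0).
    by move/(e x x0) => h'; rewrite /= h' eqxx in h.
  move=> /M0P x1; rewrite -[X in balanced_locus X](reprK x) balanced_locus_pi //.
  rewrite balanced_alternating /f; set C : scurve K 0 _ := repr x.
  pose W i := hxy (pos C i).
  pose A := \prod_(i < 2 * k | ~~ odd i) crn W (edge_quad i).
  pose B := \prod_(i < 2 * k | ~~ odd i) crd W (edge_quad i).
  have nzB : B != 0.
    by apply/prodf_neq0 => i _; have [] := hxy_cross_irr (edge_quad i) x1.
  have -> : \prod_(i < 2 * k | ~~ odd i) hx (cross_ratio C (edge_quad i)) = A / B.
    rewrite /A /B -prodf_div; apply: eq_bigr => i _.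
    by have [_ _ ->] := hxy_cross_irr (edge_quad i) x1.
  rewrite [X in _ <-> _ - X = 0]big1 => [|i _]; last first.
    by have [_ _ ->] := hxy_cross_irr (edge_quad i) x1.
  rewrite [X in X = _ <-> _](_ : _ = A); last first.
    by apply: eq_bigr => i _; rewrite /crn /= !(tnth_inord _ ord0).
  rewrite [X in _ = X <-> _](_ : _ = B); last first.
    by apply: eq_bigr => i _; rewrite /crd /= !(tnth_inord _ ord0).
  by split=> [->|/subr0_eq h]; [rewrite divff ?subrr | rewrite -[A](divfK nzB) h mul1r].
apply: openI; first exact: open_M0.
apply: (@Mbar0_open_subbase _ _ _ f); apply: mhomog_sub.
  by apply: mhomog_prod => i; apply: mhomog_x.
by apply: mhomog_prod => i; apply: mhomog_y.
Qed.

End BalancedLocus.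

(** * Divisors on an irreducible nodal curve *)

Section Divisors.
Variable K : closedFieldType.
Implicit Types (p q : P1 K) (F G : {poly K}).

(** Over an algebraically closed field both polynomials split into linear factors, here with the
    same roots. *)
Lemma mup_eq_scale F G : F != 0 -> G != 0 -> (forall x, mup x F = mup x G) ->
  exists2 c : K, c != 0 & F = c *: G.
Proof.
move=> F0 G0 e; have [r Er] := closed_field_poly_normal F.
have [s Es] := closed_field_poly_normal G.
have lF : lead_coef F != 0 by rewrite lead_coef_eq0.
have lG : lead_coef G != 0 by rewrite lead_coef_eq0.
exists (lead_coef F / lead_coef G); first by rewrite mulf_neq0 ?invr_eq0.
suff rs : perm_eq r s.
  by rewrite [LHS]Er (perm_big s rs) /= -[\prod_(_ <- _) _](scalerK lG) -Es scalerA.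
have mupZ (c x : K) (P : {poly K}) : c != 0 -> mup x (c *: P) = mup x P.
  by move=> c0; rewrite -mul_polyC mupMr // rootC.
apply/allP => x _ /=; apply/eqP.
by have := e x; rewrite [X in mup x X = _]Er [X in _ = mup x X -> _]Es !mupZ // !mu_prod_XsubC.
Qed.

(* Chosen so that its value at [p] is [bracket p q]. *)
Definition lin q : {poly K} := if q is Some y then 'X - y%:P else (-1)%:P.

Lemma lin_neq0 q : lin q != 0.
Proof. by case: q => [y|]; rewrite ?polyXsubC_eq0 // polyC_eq0 oppr_eq0 oner_eq0. Qed.

Lemma mup_lin x q : mup x (lin q) = (q == Some x).
Proof.
case: q => [y|] /=; last by rewrite mupNroot // rootC oppr_eq0 oner_eq0.
rewrite (mup_XsubCX 1); case: eqVneq => [->|n]; first by rewrite eqxx.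
by case: eqP => // -[e]; rewrite e eqxx in n.
Qed.

Lemma size_lin q : size (lin q) = (q != None).+1.
Proof. by case: q => [y|] /=; rewrite ?size_XsubC // size_polyC oppr_eq0 oner_eq0. Qed.

Definition linprod (I : finType) (P : pred I) (x : I -> P1 K) : {poly K} :=
  \prod_(i | P i) lin (x i).

(** At infinity the leading coefficient serves as the value, in accordance with [rat_val]. *)
Definition val_at F p : K := if p is Some x then F.[x] else lead_coef F.

Section LinProd.
Variables (I : finType) (P : pred I) (x : I -> P1 K).

Lemma linprod_neq0 : linprod P x != 0.
Proof. by apply/prodf_neq0 => i _; apply: lin_neq0. Qed.

Lemma mup_linprod y : mup y (linprod P x) = (\sum_(i | P i) (x i == Some y))%N.
Proof.
rewrite /linprod; suff [] : \prod_(i | P i) lin (x i) != 0 /\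
  mup y (\prod_(i | P i) lin (x i)) = (\sum_(i | P i) (x i == Some y))%N by [].
elim/big_rec2: _ => [|i n F Pi [nF IH]].
  by rewrite mupNroot ?root1 ?oner_neq0.
by rewrite mulf_neq0 ?mupM ?lin_neq0 // IH mup_lin.
Qed.

Lemma size_linprod : size (linprod P x) = (\sum_(i | P i) (x i != None)).+1.
Proof.
rewrite size_prod => [|i _]; last exact: lin_neq0.
rewrite (eq_bigr (fun i => (x i != None) + 1)%N) => [|i _]; last by rewrite size_lin addn1.
by rewrite big_split /= sum1_card -addSn addnK.
Qed.

Lemma val_at_linprod p : (forall i, x i != p) ->
  val_at (linprod P x) p = \prod_(i | P i) bracket p (x i).
Proof.
case: p => [y|] h /=.
  rewrite horner_prod; apply: eq_bigr => i _; rewrite /bracket.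
  by case: (x i) => [z|] /=; rewrite ?hornerE /=; ring.
rewrite lead_coef_prod; apply: eq_bigr => i _; have := h i; rewrite /bracket.
by case: (x i) => [z|] //= _; rewrite lead_coefXsubC; ring.
Qed.

End LinProd.

Variables (k : nat) (D : curve K (2 * k)).
Hypothesis D1 : ncomp D = 1%N.
(** [F0 / G0] is the function with simple zeros at the first [k] marked points and simple poles at
    the others. *)
Let F0 := linprod (fun i : 'I_(2 * k) => i < k)%N (pos D).
Let G0 := linprod (fun i : 'I_(2 * k) => ~~ (i < k))%N (pos D).

Lemma sum_ones_minus_ones p :
  \sum_(i < 2 * k | pos D i == p) @ones_minus_ones k i =
  (\sum_(i < 2 * k | (i < k)%N) (pos D i == p))%N%:Z -
  (\sum_(i < 2 * k | ~~ (i < k)%N) (pos D i == p))%N%:Z.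
Proof.
rewrite !(big_morph Posz PoszD (erefl _)) -sumrN big_mkcond [RHS]addrC.
rewrite [RHS](_ : _ = \sum_(i < 2 * k)
  if (i < k)%N then (pos D i == p)%:Z else - (pos D i == p)%:Z).
  by apply: eq_bigr => i _; rewrite /ones_minus_ones; case: eqP; case: ltnP.
rewrite [RHS](bigID (fun i : 'I_(2 * k) => i < k)%N) /= addrC; congr (_ + _).
  by apply: eq_bigr => i ->.
by apply: eq_bigr => i /negbTE ->.
Qed.

Lemma rat_ord_linprod p :
  rat_ord F0 G0 p = \sum_(i < 2 * k | pos D i == p) @ones_minus_ones k i.
Proof.
rewrite sum_ones_minus_ones; case: p => [y|] /=; first by rewrite !mup_linprod.
(* At infinity the order is a difference of degrees, which count the finite marked points; the
   halves having equal size, this turns into a count of those at infinity. *)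
have cnt (P : pred 'I_(2 * k)) : (\sum_(i | P i) (pos D i == None) +
     \sum_(i | P i) (pos D i != None))%N = #|P|.
  by rewrite -big_split -sum1_card; apply: eq_bigr => i _; case: eqP.
rewrite !size_linprod.
have := cnt (fun i => i < k)%N; have := cnt (fun i => ~~ (i < k))%N.
have -> : #|(fun i : 'I_(2 * k) => ~~ (i < k)%N)| = #|(fun i : 'I_(2 * k) => (i < k)%N)|.
  have e := big_half k addn (fun b : bool => if b then 1%N else 0%N).
  rewrite -!sum1_card big_mkcond [RHS]big_mkcond.
  exact: esym e.
move=> /=; set S1 := (\sum_(_ | _) _)%N; set S2 := (\sum_(_ | _) _)%N.
set S3 := (\sum_(_ | _) _)%N; set S4 := (\sum_(_ | _) _)%N.
by move: S1 S2 S3 S4 #|_| => S1 S2 S3 S4 N; lia.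
Qed.

Lemma coprime_linprod : coprimep F0 G0.
Proof.
apply/Pdiv.ClosedField.coprimepP => y.
rewrite -[_ != 0]/(~~ root G0 y) -!dvdp_XsubCl !XsubC_dvd ?linprod_neq0 //.
rewrite !mup_linprod -leqNgt leqn0 !lt0n sum_nat_eq0 negb_forall.
case/existsP => i; rewrite negb_imply eqb0 negbK => /andP[ik /eqP iy].
rewrite sum_nat_eq0; apply/forallP => j; apply/implyP => jk.
rewrite eqb0 -iy (inj_eq (pos_inj D1)); apply: contraNneq jk => ->.
by [].
Qed.

Lemma pos_neq_node i x : pos D i != (special (c := D) (inr x)).2.
Proof.
apply/eqP => e; suff : inl i = inr x :> 'I_(2 * k) + 'I_(nnode D) * bool by [].
apply: (@special_inj _ _ D); rewrite [LHS]surjective_pairing [RHS]surjective_pairing.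
by congr (_, _) => //; apply: ord_eq1.
Qed.

Lemma rat_val_linprod p : (forall i, pos D i != p) -> rat_val F0 G0 p =
  \prod_(i < 2 * k | (i < k)%N) bracket p (pos D i) /
  \prod_(i < 2 * k | ~~ (i < k)%N) bracket p (pos D i).
Proof. by move=> h; rewrite -!val_at_linprod //; case: p h. Qed.

Lemma node_balancedE : node_balanced D <-> forall e : 'I_(nnode D),
  rat_val F0 G0 (special (c := D) (inr (e, false))).2 =
  rat_val F0 G0 (special (c := D) (inr (e, true))).2.
Proof.
suff h (e : 'I_(nnode D)) : balanced (@node_config _ _ D e) <->
    rat_val F0 G0 (special (c := D) (inr (e, false))).2 =
    rat_val F0 G0 (special (c := D) (inr (e, true))).2.
  by split=> b e; apply/h.
rewrite !rat_val_linprod => [|i|i]; rewrite ?pos_neq_node //.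
set q := fun b => (special (c := D) (inr (e, b))).2.
have nz b (P : pred 'I_(2 * k)) : \prod_(i < 2 * k | P i) bracket (q b) (pos D i) != 0.
  by apply/prodf_neq0 => i _; rewrite bracket_eq0 eq_sym pos_neq_node.
have E (s : bool -> bool) : \prod_(i < 2 * k) br (hxy (q (s (i < k)%N))) (hxy (pos D i)) =
  \prod_(i < 2 * k | (i < k)%N) bracket (q (s true)) (pos D i) *
  \prod_(i < 2 * k | ~~ (i < k)%N) bracket (q (s false)) (pos D i).
  rewrite (bigID (fun i : 'I_(2 * k) => i < k)%N) /=; congr (_ * _).
    by apply: eq_bigr => i ->.
  by apply: eq_bigr => i /negbTE ->.
rewrite /balanced /node_config (E id) (E negb) -/(q true) -/(q false) /=.
by split=> [e'|/eqP]; [apply/eqP; rewrite eqr_div ?nz // -e' | rewrite eqr_div ?nz // => /eqP].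
Qed.

(** Any other function with the same divisor is a constant multiple of [F0 / G0], and the constant
    cancels when the values at two branches are compared. *)
Lemma trivial_in_PicE : trivial_in_Pic (@ones_minus_ones k) D <-> node_balanced D.
Proof.
rewrite node_balancedE; split=> [[F [G [nF nG co ordFG vFG]]]|h]; last first.
  exists F0, G0; split; rewrite ?linprod_neq0 //; first exact: coprime_linprod.
  exact: rat_ord_linprod.
have nF0 : F0 != 0 := linprod_neq0 _ _; have nG0 : G0 != 0 := linprod_neq0 _ _.
have [c c0 Ec] : exists2 c : K, c != 0 & F * G0 = c *: (G * F0).
  apply: mup_eq_scale; rewrite ?mulf_neq0 // => y; rewrite !mupM //.
  by have := ordFG (Some y); rewrite -rat_ord_linprod /=; lia.
have valM p (P Q : {poly K}) : val_at (P * Q) p = val_at P p * val_at Q p.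
  by case: p => [y|] /=; rewrite ?hornerM ?lead_coefM.
have valZ p a (P : {poly K}) : val_at (a *: P) p = a * val_at P p.
  by case: p => [y|] /=; rewrite ?hornerZ ?lead_coefZ.
have ratE p (P Q : {poly K}) : rat_val P Q p = val_at P p / val_at Q p by case: p.
(* At an unmarked finite point [F] and [G] have the same multiplicity, which coprimality forces to
   be zero. *)
have nzG p : (forall i, pos D i != p) -> val_at G p != 0.
  move=> hp; case: p hp => [y|] hp /=; last by rewrite lead_coef_eq0.
  apply/negP => Gy; have := ordFG (Some y).
  rewrite big_pred0 => [/eqP|i]; last by rewrite (negbTE (hp i)).
  rewrite /= subr_eq0 => /eqP [e].
  have /Pdiv.ClosedField.coprimepP/(_ y) := co.
  rewrite -dvdp_XsubCl XsubC_dvd // e -XsubC_dvd // dvdp_XsubCl.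
  by move=> /(_ Gy); rewrite -[_ != 0]/(~~ root G y) /root Gy.
have nzG0 p : (forall i, pos D i != p) -> val_at G0 p != 0.
  move=> hp; rewrite val_at_linprod //; apply/prodf_neq0 => i _.
  by rewrite bracket_eq0 eq_sym.
have rE p : (forall i, pos D i != p) -> rat_val F G p = c * rat_val F0 G0 p.
  move=> hp; rewrite !ratE mulrA; apply/eqP; rewrite eqr_div ?nzG ?nzG0 //.
  by rewrite -valM Ec valZ valM mulrAC mulrA.
move=> e; have := vFG e; rewrite !rE => [/(mulfI c0)//|i|i]; exact: pos_neq_node.
Qed.

End Divisors.

(** * [Lambda] as the closure of the balanced locus *)

Section LambdaClosure.
Variables (K : closedFieldType) (k : nat) (v : 'I_(2 * k) -> 'I_(2 * k)).
Hypothesis hv_alt : alternating v.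

(** Its openness is what shows that taking the closure in [Delta] creates no new points over
    [M0]. *)
Let unbalanced : set (Delta K (2 * k)) := [set y |
  ncomp (repr y : scurve K 1 (2 * k)) = 1%N /\
  ~ node_balanced (repr y : scurve K 1 (2 * k))].

Let repr_clutch (x : Mbar0 K (2 * k).+2) :
  iso (repr (clutch x) : scurve K 1 (2 * k)) (glue (repr x : scurve K 0 (2 * k).+2)).
Proof.
apply/(Mrat_eqP (repr (clutch x) : scurve K 1 (2 * k)) (sglue (repr x))).
exact: (reprK (clutch x)).
Qed.

(* The clutching map identifies two irreducible curves only by exchanging the
   two poles, which preserves the balance condition. *)
Lemma clutch_unbalanced :
  @clutch K (2 * k) @^-1` unbalanced = @M0 K (2 * k).+2 `\` @balanced_locus K k.
Proof.
have nc x : ncomp (repr (clutch x) : scurve K 1 (2 * k)) =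
            ncomp (repr x : scurve K 0 (2 * k).+2).
  by rewrite (iso_ncomp (repr_clutch x)).
apply/seteqP; split => x; rewrite /unbalanced /balanced_locus /= nc.
  move=> [x1 nb]; split; first exact/M0P.
  case=> _ b; apply: nb; apply: iso_node_balanced (iso_sym (repr_clutch x)) b.
  exact: x1.
case=> /[dup] x0 /M0P x1 nb; split=> // b; apply: nb; split=> //.
by apply: iso_node_balanced (repr_clutch x) b; rewrite nc.
Qed.

(** Openness in the quotient topology is openness of the preimage. *)
Lemma open_clutch_unbalanced : open unbalanced.
Proof.
have : open (@clutch K (2 * k) @^-1` unbalanced).
  by rewrite clutch_unbalanced; apply: open_unbalanced hv_alt.
by [].
Qed.

Lemma LambdaE : @Lambda K (2 * k) (@ones_minus_ones k) = closure (@balanced_locus K k).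
Proof.
rewrite /Lambda; congr closure; apply/seteqP; split => x.
  case=> clx x0; apply: contrapT => nb.
  have : unbalanced (clutch x).
    suff : (@clutch K (2 * k) @^-1` unbalanced) x by [].
    by rewrite clutch_unbalanced.
  (* An unbalanced [x] would give its image a neighbourhood that must meet the Chen-Coskun locus,
     all of whose points are balanced. *)
  move=> ux; have /clx[y [[C [-> C1 tC]] [D1 nD]]] : nbhs (clutch x) unbalanced.
    by apply: open_nbhs_nbhs; split=> //; exact: open_clutch_unbalanced.
  apply: nD; apply: iso_node_balanced (C1) _ _; last exact/trivial_in_PicE.
  apply/(Mrat_eqP C (repr (\pi_(Delta K (2 * k)) C))).
  exact: (esym (reprK (\pi_(Delta K (2 * k)) C))).
case=> x0 b; split=> //; apply: subset_closure.
exists (sglue (repr x)); split=> //; first exact/M0P.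
by apply/trivial_in_PicE => //; apply/M0P.
Qed.

End LambdaClosure.

(** * From planar realizations to the balance condition *)

Section PlanarToBalanced.
Variables (K : fieldType).

Lemma plane_line (x y : 'rV[K]_3) : exists l : 'cV[K]_3,
  [/\ l != 0, x *m l = 0 & y *m l = 0].
Proof.
pose A : 'M[K]_(3, 1 + 1) := row_mx x^T y^T.
have : kermx A != 0.
  by rewrite -mxrank_eq0 mxrank_ker -lt0n subn_gt0 (leq_ltn_trans (rank_leq_col _)).
case/rowV0Pn => u /sub_kermxP uA u0.
exists u^T; rewrite trmx_eq0; split=> //; apply/trmx_inj; rewrite trmx_mul trmxK trmx0.
  by move: uA; rewrite mul_mx_row -(@row_mx0 _ _ 1 1) => /eq_row_mx[].
by move: uA; rewrite mul_mx_row -(@row_mx0 _ _ 1 1) => /eq_row_mx[].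
Qed.

Definition proj (P : 'M[K]_(3, 2)) (x : 'rV[K]_3) : K * K :=
  ((x *m P) ord0 ord0, (x *m P) ord0 ord_max).

(* The matrix with rows [p], [a], [b] multiplied by that with columns [l], [P]
   is singular; expand its determinant along the first column. *)
Lemma collinear_proj (P : 'M[K]_(3, 2)) (l : 'cV[K]_3) (p a b : 'rV[K]_3) :
  collinear p a b -> p *m l = 0 ->
  (a *m l) ord0 ord0 * br (proj P p) (proj P b) =
  (b *m l) ord0 ord0 * br (proj P p) (proj P a).
Proof.
case=> h h0 [ph ah bh] pl.
pose r (i : nat) := if i is 0%N then p else if i is 1%N then a else b.
pose c (i : nat) (x : 'rV[K]_3) := if i is 0%N then (x *m l) ord0 ord0
  else if i is 1%N then (proj P x).1 else (proj P x).2.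
pose A : 'M[K]_3 := \matrix_(i < 3) r i.
pose B : 'M[K]_3 := \matrix_(t < 3, j < 3)
  if (j : nat) is 0%N then l t ord0 else if (j : nat) is 1%N then P t ord0 else P t ord_max.
have /eqP detA : \det A == 0.
  rewrite -det_tr; apply/det0P; exists h^T; first by rewrite trmx_eq0.
  apply/trmx_inj; rewrite trmx_mul !trmxK trmx0; apply/row_matrixP => i.
  by rewrite row_mul rowK row0; case: i => [[|[|[|]]]].
have pl0 : (p *m l) ord0 ord0 = 0 by rewrite pl mxE.
have AB : A *m B = \matrix_(i < 3, j < 3) c j (r i).
  apply/matrixP => i j; rewrite !mxE /c /proj /=.
  by case: j => [[|[|[|]]]] //= hj; rewrite !mxE; apply: eq_bigr => t _; rewrite !mxE.
have : \det (A *m B) = 0 by rewrite det_mulmx detA mul0r.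
rewrite AB (det_mx3 (fun i j => c j (r i))) /c /r /= pl0 => e; rewrite /br /proj /=.
apply/eqP; rewrite -subr_eq0; apply/eqP; rewrite -[RHS]oppr0 -[in RHS]e; ring.
Qed.

Variables (k : nat) (v : 'I_(2 * k) -> 'I_(2 * k)).
Hypothesis hv_alt : alternating v.

Lemma in_triangle (i : 'I_(2 * k)) x : (x \in triangle v (i, odd i)) =
  [|| x == label (inl (v i)), x == label (inl (v (ordS i))) | x == label (inr (odd i))].
Proof. by rewrite !finset.inE -orbA. Qed.

Lemma triangle_bipyramid (i : 'I_(2 * k)) : triangle v (i, odd i) \in bipyramid v.
Proof. by apply/imsetP; exists (i, odd i); rewrite ?finset.inE /black. Qed.

Lemma bipyramidP (A : {set 'I_(2 * k).+2}) :
  A \in bipyramid v -> exists i : 'I_(2 * k), A = triangle v (i, odd i).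
Proof.
by case/imsetP => -[i b]; rewrite finset.inE /black /= => /eqP <- ->; exists i.
Qed.

(** Every black triangle relates the brackets of one pole with two adjacent vertices. When these
    relations are multiplied around the equator, the values [z] at the vertices of the form defining
    the line through the poles cancel. *)
Lemma hypertree_locus_balanced :
  @hypertree_locus K (2 * k).+2 (bipyramid v) `<=` @balanced_locus K k.
Proof.
move=> _ [C [-> C1 [p [P [[p0 plan] rP pP]]]]].
apply/balanced_locus_pi => //.
pose q x := p (label x); pose W x := proj P (q x).
have Wnz i : ((proj P (p i)).1 != 0) || ((proj P (p i)).2 != 0).
  have [+ _] := pP i; apply: contraNT; rewrite negb_or !negbK => /andP[/eqP e1 /eqP e2].
  apply/eqP/rowP => j; rewrite [RHS]mxE.
  have [->|->] : j = ord0 \/ j = ord_max; [|exact: e1|exact: e2].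
  by case: j => [[|[|[]]]] // hj; [left|right]; apply/val_inj.
have posE i : pos C i = ratio (proj P (p i)).1 (proj P (p i)).2 by case: (pP i).
have peq : pequiv W (fun x => hxy (pos C (label x))).
  have -> : (fun x => hxy (pos C (label x))) =
      (fun i => hxy (ratio (proj P (p i)).1 (proj P (p i)).2)) \o @label (2 * k).
    by apply/funext => x; rewrite posE.
  exact: pequiv_comp (pequiv_ratio Wnz).
apply: pequiv_balanced peq _.
have neq i j : i != j -> ~~ (p i == p j)%MS.
  apply: contraNN => /eqmxP/eqmx_sym e; have /submxP[D pD] : (p i <= p j)%MS by rewrite e.
  rewrite -(inj_eq (pos_inj C1)) !posE.
  have {}pD : p i = D ord0 ord0 *: p j by rewrite pD -mul_scalar_mx -mx11_scalar.
  have PD : proj P (p i) = (D ord0 ord0 * (proj P (p j)).1, D ord0 ord0 * (proj P (p j)).2).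
    by rewrite {1}/proj pD -scalemxAl; congr (_, _); rewrite [LHS]mxE.
  rewrite PD ratio_scale //; apply/negP => /eqP D0.
  by have := Wnz i; rewrite PD D0 !mul0r eqxx.
have [l [l0 l1 l2]] := plane_line (q (inr false)) (q (inr true)).
have ql b : q (inr b) *m l = 0 by case: b.
pose z i := (q (inl i) *m l) ord0 ord0.
(* A vertex on the line through the poles would be collinear with them, but no triangle contains
   both poles. *)
have z0 i : z i != 0.
  apply/eqP => zi.
  have ncoll : collinear (q (inr false)) (q (inr true)) (q (inl i)).
    by exists l => //; split=> //; apply/matrixP => a b; rewrite !ord1 [RHS]mxE.
  have nlab x y : x != y -> ~~ (q x == q y)%MS.
    by move=> xy; apply: neq; rewrite (inj_eq (@label_inj _)).
  have /(plan _ _ _ (nlab _ _ _) (nlab _ _ _) (nlab _ _ _))[] := ncoll => //.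
  move=> A /bipyramidP[j ->] [f t _]; move: f t.
  by rewrite !in_triangle !(inj_eq (@label_inj _)) /=; case: odd.
have edge (i : 'I_(2 * k)) : z (v i) * br (W (inr (odd i))) (W (inl (v (ordS i)))) =
         z (v (ordS i)) * br (W (inr (odd i))) (W (inl (v i))).
  apply: collinear_proj; last exact: ql.
  have nlab x y : x != y -> ~~ (q x == q y)%MS.
    by move=> xy; apply: neq; rewrite (inj_eq (@label_inj _)).
  have Sne : v i != v (ordS i).
    by rewrite (inj_eq hv_alt.1); apply/eqP => e; have := odd_ordS i; rewrite -e; case: odd.
  apply/(plan _ _ _ (nlab _ _ _) (nlab _ _ _) (nlab _ _ _)) => //.
  exists (triangle v (i, odd i)); first exact: triangle_bipyramid.
  by rewrite !in_triangle !eqxx ?orbT.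
apply/(balanced_alternating hv_alt); rewrite !big_split /=.
set Yev := \prod_(i < _ | _) _; set Xodd := \prod_(i < _ | _) _.
set Yodd := \prod_(i < _ | _) _; set Xev := \prod_(i < _ | _) _.
pose zev := \prod_(i < 2 * k | ~~ odd i) z (v i).
pose zodd := \prod_(i < 2 * k | ~~ odd i) z (v (ordS i)).
have nzev : zev != 0 by apply/prodf_neq0.
have nzodd : zodd != 0 by apply/prodf_neq0.
(* Edges of even index pass through the pole [false], those of odd index through the pole [true]. *)
have eY : zev * Yodd = zodd * Yev.
  rewrite -!big_split /=; apply: eq_bigr => i /negbTE ei.
  by have := edge i; rewrite ei.
have eX : zodd * Xev = zev * Xodd.
  rewrite [Xev]prod_even_ordS [zev]prod_even_ordS.
  rewrite [zodd](_ : _ = \prod_(i < 2 * k | odd i) z (v i)); last by rewrite prod_odd_ordS.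
  rewrite [Xodd](_ : _ = \prod_(i < 2 * k | odd i) br (W (inr true)) (W (inl (v i))));
    last by rewrite prod_odd_ordS.
  rewrite -!big_split /=; apply: eq_bigr => i oi.
  by have := edge i; rewrite oi.
apply: (mulfI (mulf_neq0 nzev nzodd)).
transitivity ((zodd * Yev) * (zev * Xodd)); first by ring.
by rewrite -eY -eX; ring.
Qed.

End PlanarToBalanced.

(** * Polygons with sides through the poles *)

Section LineCurve.
Variables (K : fieldType) (m : nat) (q : 'I_m -> P1 K).
Hypotheses (q_inj : injective q) (m_gt2 : (2 < m)%N).

Let line_special (x : 'I_m + 'I_0 * bool) : 'I_1 * P1 K :=
  (ord0, if x is inl i then q i else None).

Let line_special_inj : injective line_special.
Proof. by move=> [i|[[]//]] [j|[[]//]] [/q_inj->]. Qed.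

Definition line_curve : curve K m := Curve line_special_inj.

Lemma line_curve_stable : stable 0 line_curve.
Proof.
apply/and4P; split => //.
  by apply/forallP => u; apply/forallP => w; rewrite !ord1 connect0.
apply/forallP => u; rewrite special_count; apply: leq_trans m_gt2 (leq_trans _ (leq_addr _ _)).
rewrite -[X in (X <= _)%N]card_ord; apply/subset_leq_card/fintype.subsetP => i _.
by rewrite inE; apply/eqP/ord_eq1.
Qed.

End LineCurve.

Section Polygon.
Variable k : nat.
Local Notation n := (2 * k)%N.

(* The vertex [a] of the polygon is the intersection of the lines numbered
   [a - 1] and [a]; of these, [line b a] is the one through the pole [b]. *)
Definition line (b : bool) (a : 'I_n) : 'I_n := if odd a == b then a else ord_pred a.

Lemma odd_line b a : odd (line b a) = b.
Proof.
rewrite /line; case: eqP => // /eqP; rewrite -{1}(ord_predK a) odd_ordS.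
by case: odd b => [] [].
Qed.

Lemma lineE b a (e : 'I_n) : odd e = b -> (line b a == e) = (a == e) || (a == ordS e).
Proof.
move=> <-; rewrite /line; case: (eqVneq a e) => [->|ae]; first by rewrite !eqxx.
have [->|aSe] := eqVneq a (ordS e).
  by rewrite odd_ordS; case: odd; rewrite /= ordSK eqxx.
case: ifP => _; first exact: negbTE.
by apply/negbTE; apply: contraNneq aSe => <-; rewrite ord_predK.
Qed.

(* The vertex [a] is the point of the affine plane whose two coordinates are
   those of the horizontal and vertical lines meeting there, and the poles are
   at infinity; the projection is centred at the origin. *)
Definition config (R : comNzRingType) (u : 'I_n -> R) (x : 'I_n + bool) : R * R :=
  match x with
  | inl a => (u (line true a), u (line false a))
  | inr b => (if b then (0, 1) else (1, 0))
  end.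

(** Twice the signed area of the triangle with vertices [i], [j], [l]. *)
Definition area (R : comNzRingType) (u : 'I_n -> R) (i j l : 'I_n) : R :=
  let x a := u (line true a) in let y a := u (line false a) in
  (x i - x l) * (y j - y l) - (x j - x l) * (y i - y l).

(** Distinct projections, distinct parallel sides and no three collinear vertices: what makes the
    polygon a planar realization. Stated over a ring so that it can be proved for polynomials and
    then specialized. *)
Definition generic_lines (R : comNzRingType) (u : 'I_n -> R) : Prop :=
  [/\ forall x y, x != y -> br (config u x) (config u y) != 0,
      forall i j : 'I_n, i != j -> odd i = odd j -> u i != u j &
      forall i j l : 'I_n, i != j -> j != l -> i != l -> area u i j l != 0].

Variable v : 'I_n -> 'I_n.
Hypothesis hv_alt : alternating v.

Definition vlabel (x : 'I_n + bool) : 'I_n.+2 :=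
  label (match x with inl i => inl (v i) | inr b => inr b end).

Lemma vlabel_inj : injective vlabel.
Proof. by move=> [i|b] [j|c] /label_inj [] // => [/hv_alt.1->|->]. Qed.

Lemma vlabel_bij : bijective vlabel.
Proof.
by apply: inj_card_bij vlabel_inj _; rewrite card_sum !card_ord card_bool addn2.
Qed.

(** Identifies the black triangles with the lines of the polygon, each through two consecutive
    vertices and one pole. *)
Lemma vlabel_triangle x (e : 'I_n) : (vlabel x \in triangle v (e, odd e)) =
  match x with inl a => line (odd e) a == e | inr b => b == odd e end.
Proof.
rewrite in_triangle /vlabel !(inj_eq (@label_inj _)).
case: x => [a|b]; rewrite -!sum_eqE /= ?orbF //.
by rewrite !(inj_eq hv_alt.1) lineE.
Qed.

Variables (K : fieldType) (u : 'I_n -> K).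
Hypothesis gu : generic_lines u.
Hypothesis k_gt0 : (0 < k)%N.

(** Third homogeneous coordinate: the poles lie on the line at infinity. *)
Definition height (x : 'I_n + bool) : K := if x is inl _ then 1 else 0.

Definition plane_point (x : 'I_n + bool) : 'rV[K]_3 :=
  \row_(j < 3) nth 0 [:: (config u x).1; (config u x).2; height x] j.

Lemma plane_point_mul x (l : 'cV[K]_3) : (plane_point x *m l = 0) <->
  (config u x).1 * l (inord 0) ord0 + (config u x).2 * l (inord 1) ord0 +
  height x * l (inord 2) ord0 = 0.
Proof.
set s := _ + _; have e : (plane_point x *m l) ord0 ord0 = s.
  rewrite mxE !big_ord_recl big_ord0 !mxE /= addr0 addrA /s.
  by congr (_ * l _ _ + _ * l _ _ + _ * l _ _); apply/val_inj; rewrite /= ?inordK.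
split=> [h|h]; first by rewrite -e h mxE.
by apply/matrixP => a b; rewrite !ord1 e h mxE.
Qed.

(** The line at infinity contains only the two poles; a horizontal or vertical line contains one
    pole and the vertices of at most one side; any other line contains no pole, and [area] excludes
    three vertices on it. *)
Lemma plane_point_collinear x y z : x != y -> y != z -> x != z ->
  collinear (plane_point x) (plane_point y) (plane_point z) ->
  exists e : 'I_n, [/\ vlabel x \in triangle v (e, odd e),
    vlabel y \in triangle v (e, odd e) & vlabel z \in triangle v (e, odd e)].
Proof.
have [_ gl ga] := gu.
move=> xy yz xz [l l0 [/plane_point_mul lx /plane_point_mul ly /plane_point_mul lz]].
set al := l (inord 0) ord0 in lx ly lz; set be := l (inord 1) ord0 in lx ly lz.
set ga' := l (inord 2) ord0 in lx ly lz.
have {l0} nz : [|| al != 0, be != 0 | ga' != 0].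
  apply: contraNT l0; rewrite !negb_or !negbK => /and3P[/eqP e0 /eqP e1 /eqP e2].
  apply/eqP/matrixP => i j; rewrite (ord1 j) [RHS]mxE -(inord_val i).
  by case: i => [[|[|[]]]].
pose on x := (config u x).1 * al + (config u x).2 * be + height x * ga' = 0.
(* The lines through the pole [b] other than the line at infinity: vertices on one of them share the
   coordinate [c], hence a side. *)
have pencil b c : (forall a, on (inl a) -> u (line b a) = c) -> ~ on (inr (~~ b)) ->
    exists e : 'I_n, [/\ vlabel x \in triangle v (e, odd e),
      vlabel y \in triangle v (e, odd e) & vlabel z \in triangle v (e, odd e)].
  move=> onl onr.
  have onb b' : on (inr b') -> b' = b.
    by move=> h; apply/eqP/negPn/negP => b'b; apply: onr; case: b b' b'b h {onl} => [] [].
  have [a oa] : exists a, on (inl a).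
    case: x y xy lx ly {xz yz} => [a|b1] [a'|b2] // => [_ h _|_ h _|_ _ h|+ h1 h2];
      [by exists a | by exists a | by exists a' |].
    by rewrite (onb _ h1) (onb _ h2) eqxx.
  exists (line b a); rewrite !vlabel_triangle odd_line.
  have onP w : on w -> match w with inl a' => line b a' == line b a | inr b' => b' == b end.
    case: w => [a' oa'|b' /onb->//]; apply/negPn/negP => ne.
    by have := gl _ _ ne; rewrite !odd_line (onl _ oa) (onl _ oa') eqxx => /(_ erefl).
  by split; apply: onP.
have [al0|al0] := eqVneq al 0; have [be0|be0] := eqVneq be 0.
- have ga0 : ga' != 0 by move: nz; rewrite al0 be0 eqxx.
  have inrP w : on w -> exists b, w = inr b.
    case: w => [a|b _]; last by exists b.
    by rewrite /on al0 be0 !mulr0 !add0r mul1r => /eqP; rewrite (negbTE ga0).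
  have [[[b1 e1] [b2 e2]] [b3 e3]] := (inrP _ lx, inrP _ ly, inrP _ lz).
  by move: xy yz xz; rewrite e1 e2 e3; case: b1 b2 b3 {e1 e2 e3} => [] [] [].
- apply: (pencil false (- ga' / be)) => [a|].
    rewrite /on al0 /= mulr0 add0r mul1r => /eqP; rewrite addr_eq0 => /eqP <-.
    by rewrite mulfK.
  by rewrite /on /= al0 mulr0 mul1r mul0r add0r addr0; apply/eqP.
- apply: (pencil true (- ga' / al)) => [a|].
    rewrite /on be0 /= mulr0 addr0 mul1r => /eqP; rewrite addr_eq0 => /eqP <-.
    by rewrite mulfK.
  by rewrite /on /= be0 mulr0 mul1r mul0r !addr0; apply/eqP.
have inlP w : on w -> exists a, w = inl a.
  case: w => [a _|[]]; first by exists a.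
    by rewrite /on /= !mul0r mul1r add0r addr0 => /eqP; rewrite (negbTE be0).
  by rewrite /on /= !mul0r mul1r !addr0 => /eqP; rewrite (negbTE al0).
have [[[i ei] [j ej]] [a ea]] := (inlP _ lx, inlP _ ly, inlP _ lz).
move: xy yz xz lx ly lz; rewrite ei ej ea => ij ja ia /= lx ly lz.
have /eqP[] := ga i j a ij ja ia; apply: (mulIf al0); rewrite mul0r /area.
pose S a' := u (line true a') * al + u (line false a') * be + 1 * ga'.
transitivity ((S i - S a) * (u (line false j) - u (line false a)) -
              (S j - S a) * (u (line false i) - u (line false a))); first by rewrite /S; ring.
by rewrite /S lx ly lz; ring.
Qed.

Lemma triangle_collinear (e : 'I_n) x y z : vlabel x \in triangle v (e, odd e) ->
  vlabel y \in triangle v (e, odd e) -> vlabel z \in triangle v (e, odd e) ->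
  collinear (plane_point x) (plane_point y) (plane_point z).
Proof.
rewrite !vlabel_triangle => hx hy hz.
(* The line [x = u e] for odd [e], and [y = u e] for even [e]. *)
pose l : 'cV[K]_3 := \col_(i < 3) nth 0 [:: (odd e)%:R; (~~ odd e)%:R; - u e] i.
have lE i : (i < 3)%N -> l (inord i) ord0 = nth 0 [:: (odd e)%:R; (~~ odd e)%:R; - u e] i.
  by move=> i3; rewrite mxE inordK.
have onl w : match w with inl a => line (odd e) a == e | inr b => b == odd e end ->
    plane_point w *m l = 0.
  move=> h; apply/plane_point_mul; rewrite !lE //=.
  case: w h => [a|b] /eqP /=; last by move=> ->; case: odd; rewrite /=; ring.
  by case: odd => /= ->; ring.
exists l; last by split; apply: onl.
apply/eqP => l0; have := lE 0%N isT; have := lE 1%N isT; rewrite l0 !mxE /=.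
by case: odd => /= [_ /esym/eqP|/esym/eqP]; rewrite oner_eq0.
Qed.

Lemma config_neq0 x : ((config u x).1 != 0) || ((config u x).2 != 0).
Proof.
have [gb _ _] := gu.
have [y yx] : exists y, y != x.
  by case: x => [a|b]; [exists (inr true) | exists (inr (~~ b)); case: b].
apply: contraNT (gb _ _ yx); rewrite negb_or !negbK /br => /andP[/eqP-> /eqP->].
by rewrite mulr0 mul0r subrr.
Qed.

Lemma generic_lines_hypertree : exists C : scurve K 0 n.+2,
  [/\ ncomp C = 1%N, @hypertree_locus K n.+2 (bipyramid v) (\pi_(Mbar0 K n.+2) C) &
      forall x, pos C (vlabel x) = ratio (config u x).1 (config u x).2].
Proof.
have [gb _ _] := gu; have [w vK wK] := vlabel_bij.
have cnz := config_neq0.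
pose q j := ratio (config u (w j)).1 (config u (w j)).2.
have q_inj : injective q.
  move=> i j qij; apply: (can_inj wK); apply/eqP; apply/negPn/negP => /gb /eqP[].
  have [e [c [_ _ ->]]] := pequiv_ratio (W := config u \o w) (fun i => cnz (w i)).
  by rewrite -/(q i) -/(q j) qij /br subrr mulr0.
have m2 : (2 < n.+2)%N by lia.
exists (SCurve (line_curve_stable q_inj m2)); split => //; last first.
  by move=> x; rewrite /pos /= /q vK.
exists (SCurve (line_curve_stable q_inj m2)); split => //.
(* The projection forgets the last coordinate, so its centre is the origin of the affine plane. *)
exists (plane_point \o w), (pid_mx 2); split; last 2 first.
- by rewrite rank_pid_mx.
- move=> i; rewrite /=.
  have e : ((plane_point (w i) *m pid_mx 2 : 'rV_2) ord0 ord0 = (config u (w i)).1) *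
           ((plane_point (w i) *m pid_mx 2 : 'rV_2) ord0 ord_max = (config u (w i)).2).
    by split; rewrite mxE !big_ord_recl big_ord0 !mxE /= ?mulr0 ?mulr1 ?addr0 ?add0r.
  split; last by rewrite !e.
  apply/eqP => e0; have := cnz (w i); rewrite -!e e0 !mxE eqxx.
  by [].
split.
  move=> i; apply/eqP => /rowP p0; have := cnz (w i).
  by have := p0 (inord 0); have := p0 (inord 1); rewrite !mxE !inordK //= => -> ->; rewrite eqxx.
move=> i j l; rewrite /=.
have neq a b : ~~ (plane_point (w a) == plane_point (w b))%MS -> w a != w b.
  by apply: contraNN => /eqP ->; apply/eqmxP.
move=> /neq ij /neq jl /neq il; split.
  case/(plane_point_collinear ij jl il) => e; rewrite !wK => -[h1 h2 h3].
  by exists (triangle v (e, odd e)); first exact: triangle_bipyramid.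
case=> A /bipyramidP[e ->] [h1 h2 h3].
by apply: (@triangle_collinear e); rewrite wK.
Qed.

End Polygon.

(** * A polynomial family of polygons in general position *)

Section PolynomialLines.
Variables (K : fieldType) (k : nat).
Hypothesis k_ge2 : (2 <= k)%N.
Local Notation n := (2 * k)%N.
Variable c : 'I_n -> K.

(* Exponents for which sums of an exponent of odd and one of even index are
   pairwise distinct. *)
Definition line_exp (i : 'I_n) : nat := if odd i then (i.+1 * n.+1)%N else i.+1.

(** Takes the prescribed value [c i] at parameter 0, the exponents being positive; genericity is
    read off the degrees, whatever [c] is. *)
Definition line_poly (i : 'I_n) : {poly K} := 'X^(line_exp i) + (c i)%:P.

Lemma line_exp_gt0 i : (0 < line_exp i)%N.
Proof. by rewrite /line_exp; case: odd. Qed.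

Lemma line_exp_inj (i j : 'I_n) : odd i = odd j -> line_exp i = line_exp j -> i = j.
Proof.
rewrite /line_exp => ->; case: odd => [/eqP|[/val_inj]//].
by rewrite eqn_pmul2r // => /eqP[/val_inj].
Qed.

Lemma size_line_poly i : size (line_poly i) = (line_exp i).+1.
Proof.
rewrite size_polyDl size_polyXn // ltnS.
exact: leq_trans (size_polyC_leq1 _) (line_exp_gt0 i).
Qed.

Lemma size_line_polyB (i j : 'I_n) : odd i = odd j -> i != j ->
  size (line_poly i - line_poly j) = (maxn (line_exp i) (line_exp j)).+1.
Proof.
wlog lt_ij : i j / (line_exp j < line_exp i)%N => [wlog_ij oij ij|].
  case: (ltngtP (line_exp i) (line_exp j)) => [h|h|/(line_exp_inj oij) e].
  - by rewrite -opprB size_polyN wlog_ij ?(maxn_idPl (ltnW h)) // eq_sym.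
  - by rewrite wlog_ij // (maxn_idPl (ltnW h)).
  - by rewrite e eqxx in ij.
move=> _ _; rewrite {1}/line_poly -addrA size_polyDl size_polyXn.
  by rewrite (maxn_idPl (ltnW lt_ij)).
rewrite ltnS (leq_trans (size_polyD _ _)) // geq_max size_polyN size_line_poly.
by rewrite lt_ij (leq_trans (size_polyC_leq1 _)) ?line_exp_gt0.
Qed.

(** Uniqueness of digits in base [N]; with base [n.+1] it separates the contributions of the two
    kinds of lines to a degree. *)
Lemma lex_eq (N a b a' b' : nat) : (b < N)%N -> (b' < N)%N ->
  (a * N + b = a' * N + b')%N -> a = a' /\ b = b'.
Proof.
move=> bN b'N e; have N0 : (0 < N)%N by case: N bN {b'N e}.
have : (a = a')%N by have := congr1 (divn^~ N) e; rewrite /= !divnMDl // !divn_small // !addn0.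
by move=> aa; split=> //; move: e; rewrite aa => /addnI.
Qed.

(** There are at least four equatorial vertices. *)
Lemma ordS2_neq (e : 'I_n) : ordS (ordS e) != e.
Proof.
apply/eqP => /(congr1 val) /=; have := ltn_ord e => lt_e.
have -> : ((e.+1 %% n).+1 = (e.+1 %% n) + 1)%N by rewrite addn1.
rewrite modnDml addn1 => h; have [small|big] := ltnP e.+2 n.
  by move: h; rewrite modn_small //; lia.
have e2 : e.+2 = (n + (e.+2 - n))%N by lia.
by move: h; rewrite e2 modnDl modn_small; lia.
Qed.

Lemma line_share b (i j l : 'I_n) : i != j -> line b i = line b j -> line b l = line b i ->
  l = i \/ l = j.
Proof.
move=> ij e1 e2; have /eqP := e1; rewrite eq_sym lineE ?odd_line // => h1.
have /eqP := e2; rewrite lineE ?odd_line // => h2.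
have /eqP := erefl (line b i); rewrite lineE ?odd_line // => h3.
move: (line b i) ij h1 h2 h3 => e ij /orP[] /eqP h1 /orP[] /eqP h2 /orP[] /eqP h3.
all: first [by left; rewrite h2 h3 | by right; rewrite h2 h1 | by rewrite h1 h3 eqxx in ij].
Qed.

(** If two lines of different directions shared two vertices, the index of each would be the
    successor of the other, against [ordS2_neq]. *)
Lemma line_inj (i j : 'I_n) : line true i = line true j -> line false i = line false j -> i = j.
Proof.
move=> et ef; apply/eqP/negPn/negP => ij.
set e := line true i in et; set e' := line false i in ef.
have oe : odd e = true by rewrite odd_line.
have oe' : odd e' = false by rewrite odd_line.
have H b a (x : 'I_n) : odd x = b -> line b a = x -> a = x \/ a = ordS x.
  by move=> ox /eqP; rewrite lineE // => /orP[] /eqP; [left|right].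
have h1 := H _ _ _ oe (erefl e); have h2 := H _ _ _ oe (esym et).
have h3 := H _ _ _ oe' (erefl e'); have h4 := H _ _ _ oe' (esym ef).
have ee' : e <> e' by move=> h; rewrite h oe' in oe.
have n1 := ordS2_neq e; have n2 := ordS2_neq e'.
have ne := negP ij.
case: h1 => h1; case: h2 => h2; case: h3 => h3; case: h4 => h4;
  try (by case: ne; apply/eqP; congruence); try (by case: ee'; congruence).
- by move: n1; rewrite -h2 h4 -h3 h1 eqxx.
- by move: n1; rewrite -h1 h3 -h4 h2 eqxx.
Qed.

Local Notation X a := (line_poly (line true a)).
Local Notation Y a := (line_poly (line false a)).

Lemma line_poly_neq0 i : line_poly i != 0.
Proof. by rewrite -size_poly_gt0 size_line_poly. Qed.

Lemma line_polyB_neq0 (i j : 'I_n) : odd i = odd j -> i != j -> line_poly i - line_poly j != 0.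
Proof. by move=> oij ij; rewrite -size_poly_gt0 size_line_polyB. Qed.

Lemma line_polyB b i j : line b i != line b j ->
  line_poly (line b i) - line_poly (line b j) != 0.
Proof. by move=> ij; rewrite line_polyB_neq0 ?odd_line. Qed.

(** The two products have equal degree only if the larger of the [line true] indices of [i] and [l]
    equals that of [j] and [l], which makes the index of [l] the largest. *)
Lemma area_neq0_deg (i j l : 'I_n) :
  line true i != line true j -> line true j != line true l -> line true i != line true l ->
  line false i != line false j -> line false j != line false l -> line false i != line false l ->
  (line true l < line true i)%N || (line true l < line true j)%N ->
  area line_poly i j l != 0.
Proof.
move=> xij xjl xil yij yjl yil lt_l; rewrite /area subr_eq0; apply/eqP.
move/(congr1 (fun p : {poly K} => size p)).
rewrite !size_mul ?line_polyB // !size_line_polyB ?odd_line // !addSn !addnS /=.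
rewrite /line_exp !odd_line -!maxnMl => -[/lex_eq[]].
- by rewrite gtn_max !ltnS !ltn_ord.
- by rewrite gtn_max !ltnS !ltn_ord.
move=> + _; move: xij xjl xil lt_l; rewrite -!val_eqE /=.
move: (val (line true i)) (val (line true j)) (val (line true l)) => a b d.
by move=> /eqP h1 /eqP h2 /eqP h3; lia.
Qed.

(* If two of the points share a line, the area factors; otherwise it is a
   difference of two products of different degrees, provided that the base point
   does not have the largest exponent, which a cyclic permutation ensures. *)
Lemma area_neq0 (i j l : 'I_n) : i != j -> j != l -> i != l -> area line_poly i j l != 0.
Proof.
have other b (a a' : 'I_n) : a != a' -> line b a = line b a' -> line (~~ b) a != line (~~ b) a'.
  move=> aa' e; apply: contraNneq aa' => e'; apply/eqP.
  by case: b e e' => /= e e'; apply: line_inj.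
have third b (a a' a'' : 'I_n) : a != a' -> a'' != a -> a'' != a' ->
    line b a = line b a' -> line b a'' != line b a.
  move=> aa' h1 h2 e; apply/eqP => /(line_share aa' e)[] h; [by rewrite h eqxx in h1|].
  by rewrite h eqxx in h2.
move=> ij jl il.
have [ji lj li] : [/\ j != i, l != j & l != i].
  by rewrite eq_sym ij eq_sym jl eq_sym il.
have [e|xij] := eqVneq (line true i) (line true j).
  have := other true _ _ ij e; have := third true _ _ _ ij li lj e => /= h1 h2.
  have -> : area line_poly i j l = (X l - X i) * (Y i - Y j) by rewrite /area -e; ring.
  by rewrite mulf_neq0 ?line_polyB.
have [e|xjl] := eqVneq (line true j) (line true l).
  have := other true _ _ jl e; have := third true _ _ _ jl ij il e => /= h1 h2.
  have -> : area line_poly i j l = (X i - X j) * (Y j - Y l) by rewrite /area -e; ring.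
  by rewrite mulf_neq0 ?line_polyB.
have [e|xil] := eqVneq (line true i) (line true l).
  have := other true _ _ il e; have := third true _ _ _ il ji jl e => /= h1 h2.
  have -> : area line_poly i j l = - ((X j - X i) * (Y i - Y l)) by rewrite /area -e; ring.
  by rewrite oppr_eq0 mulf_neq0 ?line_polyB.
have [e|yij] := eqVneq (line false i) (line false j).
  have -> : area line_poly i j l = (X i - X j) * (Y i - Y l) by rewrite /area -e; ring.
  have h1 := third false _ _ _ ij li lj e.
  by rewrite mulf_neq0 ?line_polyB // eq_sym.
have [e|yjl] := eqVneq (line false j) (line false l).
  have -> : area line_poly i j l = - ((X j - X l) * (Y i - Y j)) by rewrite /area -e; ring.
  have h1 := third false _ _ _ jl ij il e.
  by rewrite oppr_eq0 mulf_neq0 ?line_polyB.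
have [e|yil] := eqVneq (line false i) (line false l).
  have -> : area line_poly i j l = (X i - X l) * (Y j - Y i) by rewrite /area -e; ring.
  have h1 := third false _ _ _ il ji jl e.
  by rewrite mulf_neq0 ?line_polyB.
have [lt_l|] := boolP ((line true l < line true i)%N || (line true l < line true j)%N).
  exact: area_neq0_deg.
rewrite negb_or -!leqNgt => /andP[le_i le_j].
have -> : area line_poly i j l = area line_poly j l i by rewrite /area; ring.
apply: area_neq0_deg; rewrite // 1?eq_sym //.
by rewrite orbC ltn_neqAle le_i val_eqE xil.
Qed.

Lemma generic_line_poly : generic_lines line_poly.
Proof.
split; last exact: area_neq0.
  have vertex_pole (a : 'I_n) b : br (config line_poly (inr b)) (config line_poly (inl a)) != 0.
    by case: b; rewrite /br /= ?mul0r ?mulr0 ?sub0r ?subr0 ?mulr1 ?mul1r ?oppr_eq0 line_poly_neq0.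
  move=> [a|b] [a'|b'] xy; last 2 first.
  - exact: vertex_pole.
  - by case: b b' xy => [] [] //= _; rewrite /br /= ?mul0r ?mulr0 ?mul1r ?sub0r ?subr0
      ?oppr_eq0 oner_eq0.
  (* Equality of the degrees would give the two vertices the same two lines, hence make them
     equal. *)
  - rewrite /br /= subr_eq0; apply/eqP => /(congr1 (fun p : {poly K} => size p)).
    rewrite !size_mul ?line_poly_neq0 // !size_line_poly !addSn !addnS /=.
    rewrite /line_exp !odd_line => /succn_inj/lex_eq[]; rewrite ?ltnS ?ltn_ord //.
    move=> [/val_inj e1] [/val_inj e2]; move: xy; rewrite (line_inj e1 (esym e2)).
    by rewrite eqxx.
  - by rewrite br_swap oppr_eq0 vertex_pole.
by move=> i j ij oij; rewrite -subr_eq0 line_polyB_neq0.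
Qed.

End PolynomialLines.

(** * Density of the planar configurations *)

Section Generically.
Variable K : fieldType.

(** The witnessing polynomial makes finite conjunctions into products and yields a good parameter
    over an algebraically closed field. *)
Definition generically (P : K -> Prop) : Prop :=
  exists2 g : {poly K}, g != 0 & forall s, g.[s] != 0 -> P s.

Lemma generically_horner (g : {poly K}) : g != 0 -> generically (fun s => g.[s] != 0).
Proof. by exists g. Qed.

Lemma generically_imp (P Q : K -> Prop) : (forall s, P s -> Q s) ->
  generically P -> generically Q.
Proof. by move=> PQ [g g0 gP]; exists g => // s /gP/PQ. Qed.

Lemma generically_true (P : K -> Prop) : (forall s, P s) -> generically P.
Proof. by move=> h; exists 1; rewrite ?oner_neq0. Qed.

Lemma generically_and (P Q : K -> Prop) : generically P -> generically Q ->
  generically (fun s => P s /\ Q s).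
Proof.
move=> [g g0 gP] [h h0 hQ]; exists (g * h) => [|s]; first exact: mulf_neq0.
by rewrite hornerM mulf_eq0 negb_or => /andP[/gP ? /hQ].
Qed.

Lemma generically_all (I : eqType) (r : seq I) (P : I -> K -> Prop) :
  (forall i, i \in r -> generically (P i)) ->
  generically (fun s => forall i, i \in r -> P i s).
Proof.
elim: r => [|i r IH] h; first exact: generically_true.
have hi := h i (mem_head _ _).
have hr := IH (fun j jr => h j (@mem_behead _ (i :: r) j jr)).
apply: generically_imp (generically_and hi hr) => s [Pi Pr] j.
by rewrite inE => /orP[/eqP->|/Pr].
Qed.

Lemma generically_forall (I : finType) (P : I -> K -> Prop) :
  (forall i, generically (P i)) -> generically (fun s => forall i, P i s).
Proof.
move=> h; apply: generically_imp (generically_all (r := enum I) (fun i _ => h i)).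
by move=> s hs i; apply: hs; rewrite mem_enum.
Qed.

Lemma generically_implies (B : bool) (P : K -> Prop) : (B -> generically P) ->
  generically (fun s => B -> P s).
Proof.
case: B => [/(_ isT)|_]; first exact: generically_imp.
exact: generically_true.
Qed.

End Generically.

Lemma generically_ex (K : closedFieldType) (P : K -> Prop) :
  generically P -> exists s, P s.
Proof. by case=> g /closed_nonrootP[s gs] gP; exists s; apply: gP. Qed.

Section Specialization.
Variable K : fieldType.

Definition eval_pair (s : K) (w : {poly K} * {poly K}) : K * K := (w.1.[s], w.2.[s]).

Lemma horner_br s w w' : (br w w').[s] = br (eval_pair s w) (eval_pair s w').
Proof. by rewrite /br !hornerE. Qed.

Lemma horner_crn m s (W : 'I_m -> {poly K} * {poly K}) t :
  (crn W t).[s] = crn (eval_pair s \o W) t.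
Proof. by rewrite /crn hornerM !horner_br. Qed.

Lemma horner_crd m s (W : 'I_m -> {poly K} * {poly K}) t :
  (crd W t).[s] = crd (eval_pair s \o W) t.
Proof. by rewrite /crd hornerM !horner_br. Qed.

Lemma config_eval k s (u : 'I_(2 * k) -> {poly K}) x :
  config (fun i => (u i).[s]) x = eval_pair s (config u x).
Proof. by case: x => [a|[]] //=; rewrite /eval_pair /= !hornerE. Qed.

Lemma generic_lines_eval k (u : 'I_(2 * k) -> {poly K}) : generic_lines u ->
  generically (fun s => generic_lines (fun i => (u i).[s])).
Proof.
case=> h1 h2 h3.
have g1 : generically (fun s => forall x y, x != y ->
    br (config (fun i => (u i).[s]) x) (config (fun i => (u i).[s]) y) != 0).
  apply: generically_forall => x; apply: generically_forall => y.
  apply: generically_implies => /h1/generically_horner.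
  by apply: generically_imp => s; rewrite horner_br !config_eval.
have g2 : generically (fun s => forall i j : 'I_(2 * k), i != j -> odd i = odd j ->
    (u i).[s] != (u j).[s]).
  apply: generically_forall => i; apply: generically_forall => j.
  apply: generically_implies => ij.
  have [e|ne] := eqVneq (odd i) (odd j); last first.
    by apply: generically_true => s e; rewrite e eqxx in ne.
  have := h2 _ _ ij e; rewrite -subr_eq0 => /generically_horner.
  by apply: generically_imp => s + _; rewrite hornerD hornerN subr_eq0.
have g3 : generically (fun s => forall i j l : 'I_(2 * k), i != j -> j != l -> i != l ->
    area (fun i => (u i).[s]) i j l != 0).
  apply: generically_forall => i; apply: generically_forall => j.
  apply: generically_forall => l.
  apply: generically_implies => ij; apply: generically_implies => jl.
  apply: generically_implies => il; have /generically_horner := h3 _ _ _ ij jl il.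
  by apply: generically_imp => s; rewrite /area !hornerE.
apply: generically_imp (generically_and g1 (generically_and g2 g3)) => s [? [? ?]].
by split.
Qed.

(* Evaluating a multihomogeneous form at homogeneous coordinates [(A t, B t)]
   rescales it by a monomial in the factors [c t] relating them to [(hx, hy)]. *)
Lemma mhomog_poly (I : finType) (d : I -> nat) f (A B : I -> {poly K}) :
  @mhomog K I d f -> exists g : {poly K}, forall s (z : I -> P1 K) (c : I -> K),
  (forall t, (A t).[s] = c t * hx (z t) /\ (B t).[s] = c t * hy (z t)) ->
  g.[s] = \prod_t c t ^+ d t * f z.
Proof.
have prod1 (c : I -> K) i : \prod_t c t ^+ (t == i) = c i.
  rewrite (bigD1 i) //= eqxx expr1 big1 ?mulr1 // => t /negbTE->.
  by rewrite expr0.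
elim=> {d f} [a|i|i|d f h _ [g gP] _ [g' gP']|d d' f h _ [g gP] _ [g' gP']].
- by exists a%:P => s z c _; rewrite hornerC big1 ?mul1r // => t _; rewrite expr0.
- by exists (A i) => s z c e; rewrite prod1; case: (e i).
- by exists (B i) => s z c e; rewrite prod1; case: (e i).
- by exists (g + g') => s z c e; rewrite hornerD (gP _ _ _ e) (gP' _ _ _ e) mulrDr.
exists (g * g') => s z c e; rewrite hornerM (gP _ _ _ e) (gP' _ _ _ e).
under [in RHS]eq_bigr do rewrite exprD.
by rewrite big_split /= mulrACA.
Qed.

End Specialization.

Section CyclicProducts.
Variables (K : fieldType) (N : nat).

(** [c i] is the product of [r] up to [i]; the relation at index 0, whose predecessor is the last
    index, holds because the full product is 1. *)
Lemma cyclic_potential (r : 'I_N -> K) : (forall i, r i != 0) -> \prod_i r i = 1 ->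
  exists c : 'I_N -> K, forall i, c i != 0 /\ c i = c (ord_pred i) * r i.
Proof.
move=> r0 r1; exists (fun i => \prod_(j < N | (j <= i)%N) r j) => i.
split; first by apply/prodf_neq0.
rewrite [LHS](bigD1 i) //= mulrC; have [i0|i_gt0] := posnP i.
  rewrite [X in X * _ = _]big1 => [|j]; last first.
    by rewrite -val_eqE /= i0 leqn0 => /andP[/eqP->].
  rewrite [X in _ = X * _](eq_bigl predT) ?r1 // => j.
  by rewrite /= i0 add0n modn_small; have := ltn_ord i; have := ltn_ord j; lia.
congr (_ * _); apply: eq_bigl => j; rewrite -val_eqE /=.
have -> : ((i + N).-1 = N + i.-1)%N by lia.
rewrite modnDl modn_small; last by have := ltn_ord i; lia.
lia.
Qed.

End CyclicProducts.

(** * Balanced configurations as limits of planar ones *)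

Section BalancedToPlanar.
Variables (K : closedFieldType) (k : nat) (v : 'I_(2 * k) -> 'I_(2 * k)).
Hypotheses (k_ge2 : (2 <= k)%N) (hv_alt : alternating v).
Local Notation n := (2 * k)%N.

(** The vertex [a] lies on the lines numbered [a] and [a - 1], so its direction prescribes the ratio
    [r a] of their constants; balance says that these ratios close up around the polygon. *)
Lemma balanced_config (C : curve K n.+2) : ncomp C = 1%N ->
  balanced (fun x => hxy (pos C (label x))) ->
  exists c : 'I_n -> K, pequiv (config c) (fun x => hxy (pos C (vlabel v x))).
Proof.
move=> C1 /(balanced_alternating hv_alt) bal.
pose W x := hxy (pos C (vlabel v x)).
have W0 x y : x != y -> br (W x) (W y) != 0.
  by rewrite br_hv_eq0 (inj_eq (pos_inj C1)) (inj_eq (vlabel_inj hv_alt)).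
(* By Cramer's rule, the coordinates of the vertex in the basis of the two poles, up to a common
   factor. *)
pose X a := br (W (inl a)) (W (inr true)); pose Y a := br (W (inr false)) (W (inl a)).
have X0 a : X a != 0 by apply: W0.
have Y0 a : Y a != 0 by apply: W0.
pose r (a : 'I_n) := if odd a then X a / Y a else Y a / X a.
have r0 a : r a != 0 by rewrite /r; case: odd; rewrite mulf_neq0 ?invr_eq0.
have r1 : \prod_a r a = 1.
  have eXY : \prod_(i < n | ~~ odd i) (Y i * X (ordS i)) =
             \prod_(i < n | ~~ odd i) (Y (ordS i) * X i).
    under eq_bigr do rewrite /X br_swap mulrN -mulN1r.
    under [RHS]eq_bigr do rewrite /X br_swap mulrN -mulN1r.
    by rewrite big_split [RHS]big_split /=; congr (_ * _).
  rewrite (bigID (fun a : 'I_n => odd a)) /= prod_odd_ordS -big_split /=.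
  rewrite (eq_bigr (fun i => (Y i * X (ordS i)) / (Y (ordS i) * X i))) => [|i ei].
    rewrite prodf_div eXY divff //; apply/prodf_neq0 => i _; exact: mulf_neq0.
  by rewrite /r odd_ordS ei (negbTE ei); field; rewrite X0 Y0.
have [c cP] := cyclic_potential r0 r1.
have c0 i : c i != 0 by case: (cP i).
exists c; pose d := br (W (inr false)) (W (inr true)).
have d0 : d != 0 by apply: W0.
(* On a vertex, the factor turning the second coordinate of [config c] into [Y a]; that the first
   then becomes [X a] is the relation in [cP]. *)
pose h (x : 'I_n + bool) := match x with inl a => Y a / c (line false a) | inr _ => d end.
have h0 x : h x != 0 by case: x => [a|b] //=; rewrite mulf_neq0 ?invr_eq0.
have hX x : h x * (config c x).1 = br (W x) (W (inr true)).
  case: x => [a|[]] /=; rewrite ?mulr0 ?mulr1 ?/br ?subrr //.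
  rewrite -/(br (W (inl a)) (W (inr true))) -/(X a) /line; have [_ ca] := cP a.
  by move: ca; rewrite /r; case: odd => /= ->; field; rewrite ?X0 ?Y0 ?c0.
have hY x : h x * (config c x).2 = br (W (inr false)) (W x).
  case: x => [a|[]] /=; rewrite ?mulr0 ?mulr1 ?/br ?subrr //.
  by rewrite -/(br (W (inr false)) (W (inl a))) -/(Y a) divfK.
exists d, (fun x => (h x)^-1); split=> // [x|x y]; first by rewrite invr_eq0.
apply: (mulfI (mulf_neq0 (h0 x) (h0 y))).
transitivity ((h x * (config c x).1) * (h y * (config c y).2) -
              (h y * (config c y).1) * (h x * (config c x).2)).
  by rewrite /br; ring.
rewrite !hX !hY.
(* The Grassmann-Plücker relation among four vectors of the plane. *)
transitivity (d * br (W x) (W y)); first by rewrite /d /br; ring.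
by field; rewrite !h0.
Qed.

(** The polynomial family passes through [x] at parameter 0. Each form defining a basic
    neighbourhood pulls back to a polynomial that does not vanish at 0, so a general parameter stays
    in the neighbourhood and yields a planar realization. *)
Lemma balanced_locus_closure :
  @balanced_locus K k `<=` closure (@hypertree_locus K n.+2 (bipyramid v)).
Proof.
move=> x; rewrite -[x](reprK x); set C : scurve K 0 n.+2 := repr x.
move=> bx; have C1 : ncomp C = 1%N by case: bx => /M0P; rewrite reprK.
move: bx => /(balanced_locus_pi C1)/(balanced_config C1)[c Cc].
have [w vK wK] := vlabel_bij hv_alt.
pose U := line_poly c; pose W j := config U (w j).
move=> B; rewrite nbhsE => -[V [oV Vx] VB].
move: oV; rewrite Mbar0_openE => -[D' D'sub D'V].
move: Vx; rewrite -D'V => -[T D'T Tx].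
have [F Fsub FT] := D'sub _ D'T.
have W0 j : eval_pair 0 (W j) = config c (w j).
  rewrite -config_eval; congr config; apply/funext => i.
  by rewrite /U /line_poly !hornerE expr0n gtn_eqF ?line_exp_gt0 // add0r.
have cr s (D : scurve K 0 n.+2) : ncomp D = 1%N ->
    pequiv (eval_pair s \o W) (fun j => hxy (pos D j)) -> exists e : quad n.+2 -> K,
    (forall t, e t != 0) /\ forall t,
    let z := cross_ratio (repr (\pi_(Mbar0 K n.+2) D) : scurve K 0 n.+2) t in
    (crn W t).[s] = e t * hx z /\ (crd W t).[s] = e t * hy z.
  move=> D1 WD; have /choice[e eP] := fun t => cross_ratio_scale t D1 WD.
  exists e; split=> t; first by case: (eP t).
  rewrite -(@cross_ratio_iso _ _ D) //; last first.
    apply/(Mrat_eqP D (repr (\pi_(Mbar0 K n.+2) D))).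
    exact: (esym (reprK (\pi_(Mbar0 K n.+2) D))).
  by rewrite horner_crn horner_crd; case: (eP t).
have WC : pequiv (eval_pair 0 \o W) (fun j => hxy (pos C j)).
  have -> : eval_pair 0 \o W = config c \o w by apply/funext => j; apply: W0.
  have -> : (fun j => hxy (pos C j)) = (fun x => hxy (pos C (vlabel v x))) \o w.
    by apply/funext => j; rewrite /= wK.
  exact: pequiv_comp.
(* Quantified over all curves with the given configuration, since the one needed is built only after
   [s] is chosen. *)
have gen : generically (fun s : K => forall Q, Q \in (F : seq _) -> forall D : scurve K 0 n.+2,
    ncomp D = 1%N -> pequiv (eval_pair s \o W) (fun j => hxy (pos D j)) ->
    Q (\pi_(Mbar0 K n.+2) D)).
  apply: generically_all => Q QF.
  have : @Mbar0_subbase K n.+2 Q by have := Fsub Q QF; rewrite inE.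
  case=> d [f [hf QE]].
  have [g gP] := mhomog_poly (crn W) (crd W) hf.
  have : Q (\pi_(Mbar0 K n.+2) C) by move: Tx; rewrite -FT; apply.
  have [e [e0 eP]] := cr _ _ C1 WC.
  rewrite {1}QE /= => fC; have g0 : g != 0.
    apply/eqP => g0; have /eqP := gP 0 _ e eP; rewrite g0 horner0 eq_sym.
    by rewrite mulf_eq0 (negbTE fC) orbF; apply/negP/prodf_neq0 => t _; rewrite expf_neq0.
  apply: generically_imp (generically_horner g0) => s gs D D1 /(cr _ _ D1)[e' [_ eP']].
  by rewrite QE /=; apply: contraNneq gs => fD; rewrite (gP s _ e' eP') fD mulr0.
have gl := generic_lines_eval (generic_line_poly k_ge2 c).
have [s [sF gs]] := generically_ex (generically_and gen gl).
have [|D [D1 hD posD]] := generic_lines_hypertree hv_alt gs; first by lia.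
exists (\pi_(Mbar0 K n.+2) D); split=> //; apply: VB; rewrite -D'V.
exists T => //; rewrite -FT => Q QF; apply: (sF Q QF) => //.
rewrite [X in pequiv X](_ : _ = config (fun i => (U i).[s]) \o w); last first.
  by apply/funext => j; rewrite /= config_eval.
rewrite (_ : (fun j => _) = (fun x => hxy (ratio (config (fun i => (U i).[s]) x).1
    (config (fun i => (U i).[s]) x).2)) \o w); last first.
  by apply/funext => j; rewrite /= -posD wK.
apply/pequiv_comp/pequiv_ratio.
exact: config_neq0.
Qed.

End BalancedToPlanar.

Theorem theorem4p9 (K : closedFieldType) (k : nat) (hk : (2 <= k)%N)
    (v : 'I_(2 * k) -> 'I_(2 * k)) (hv : alternating v) :
  @Lambda K (2 * k) (@ones_minus_ones k) =
  @hypertree_divisor K (2 * k).+2 (bipyramid v).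
Proof.
rewrite (LambdaE _ hv) /hypertree_divisor; apply/seteqP; split.
  (* Closure is idempotent, so it suffices to place the balanced locus inside the closure of the
     planar one. *)
  rewrite [X in _ `<=` X](_ : _ = closure (closure (@hypertree_locus K (2 * k).+2 (bipyramid v)))).
    exact/closureS/balanced_locus_closure.
  exact/closure_id/closed_closure.
exact/closureS/hypertree_locus_balanced.
Qed.
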